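(* There is an algorithm which, given a median graph $G$ with $m$ edges and a weight function $w:V\to\mathbb{R}_{\ge 0}$, computes the median set $\mathrm{Med}_w(G)$ in $O(m)$ time.
   Context: All graphs are finite, simple, connected and undirected; $d$ is the shortest-path distance and $I(u,v)=\{x: d(u,x)+d(x,v)=d(u,v)\}$. $G=(V,E)$ is a median graph if for every triple $x,y,z$ of vertices $I(x,y)\cap I(y,z)\cap I(z,x)$ is a single vertex. For a weight function $w:V\to\mathbb{R}_{\ge0}$, the median function is $F_w(x)=\sum_{v\in V}w(v)d(x,v)$, and $\mathrm{Med}_w(G)$ is the set of vertices minimizing $F_w$. The graph is given by adjacency lists. *)

(* Defs.v *)
From HB Require Import structures.
From mathcomp Require Import all_boot all_order all_algebra.
From mathcomp Require Import reals.

Set Implicit Arguments.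
Unset Strict Implicit.
Unset Printing Implicit Defensive.

Import Order.TTheory GRing.Theory Num.Theory.
Local Open Scope ring_scope.

(** * Median graphs and median sets *)

Section Graphs.
Variables (T : finType) (e : rel T).

Definition connected_simple_graph : Prop :=
  [/\ symmetric e, irreflexive e, (0 < #|T|)%N & forall x y, connect e x y].

Definition edges : {set {set T}} := [set [set x; y] | x in T, y in e x].

Definition walk (k : nat) (x y : T) : bool :=
  [exists p : k.-tuple T, path e x p && (last x p == y)].

(* The length of a shortest path; [#|T|] when [x] and [y] are disconnected.
   As [iota 0 #|T|] lists 0, 1, 2 and so on, the index returned by [find] is
   the least [k] with a walk of length [k]. *)
Definition gdist (x y : T) : nat := find (fun k => walk k x y) (iota 0 #|T|).

Definition interval (u v : T) : {set T} :=
  [set x | (gdist u x + gdist x v == gdist u v)%N].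

Definition median_graph : Prop :=
  connected_simple_graph /\
  forall x y z, #|interval x y :&: interval y z :&: interval z x| = 1%N.

Variables (R : realType) (w : T -> R).

Definition median_fun (x : T) : R := \sum_(v : T) w v * (gdist x v)%:R.

Definition median_set : {set T} :=
  [set x | [forall y, median_fun x <= median_fun y]].

Lemma gdistP x y : connect e x y ->
  walk (gdist x y) x y /\ forall k, walk k x y -> (gdist x y <= k)%N.
Proof.
move=> /connectP [p0 ep0 ->]; case/shortenP: ep0 => p ep up _ {p0}.
have szp : (size p < #|T|)%N by have /= <- := card_uniqP up; exact: max_card.
have hasw : has (fun k => walk k x (last x p)) (iota 0 #|T|).
  apply/hasP; exists (size p); first by rewrite mem_iota.
  by apply/existsP; exists (in_tuple p); rewrite ep eqxx.
have lt : (gdist x (last x p) < #|T|)%N by rewrite -[X in (_ < X)%N](size_iota 0) -has_find.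
split; first by have := nth_find 0%N hasw; rewrite -/(gdist _ _) nth_iota.
move=> k wk; rewrite leqNgt; apply/negP => ltk.
by have := before_find 0%N ltk; rewrite nth_iota ?wk // (ltn_trans ltk).
Qed.

End Graphs.

(** * The machine model: a real RAM

    Time is measured on a random access machine that has, besides its integer
    words, real registers with exact unit-cost arithmetic and comparison, as is
    needed for arbitrary real weights. Programs are deeply embedded. They use
    finitely many scalar variables and unbounded arrays, each of them either of
    integer words or of reals, all named by numerals occurring in the program.
    Array indices are words; there is no rounding, nor any other conversion
    from reals to words.

    Words are bounded: evaluation is parametrized by [B], and an integer
    expression with a subexpression of value at least [B] is undefined. *)

Inductive iop := IAdd | ISub | IMul | IDiv | IMod.

Inductive iexp :=
  | IConst of nat
  | IVar of nat
  | IGet of nat & iexp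
  | IBin of iop & iexp & iexp.

Inductive rop := RAdd | RSub | RMul | RDiv.

Inductive rexp :=
  | RConst of nat
  | RVar of nat
  | RGet of nat & iexp
  | RBin of rop & rexp & rexp.

Inductive bexp :=
  | BIle of iexp & iexp
  | BRle of rexp & rexp
  | BNot of bexp
  | BAnd of bexp & bexp.

Inductive cmd :=
  | Skip
  | ISet of nat & iexp
  | IPut of nat & iexp & iexp
  | RSet of nat & rexp
  | RPut of nat & iexp & rexp
  | Seq of cmd & cmd
  | If of bexp & cmd & cmd
  | While of bexp & cmd.

(* Every node of an expression counts for one elementary step. *)
Fixpoint icost (a : iexp) : nat :=
  match a with
  | IConst _ | IVar _ => 1
  | IGet _ i => (icost i).+1
  | IBin _ a1 a2 => (icost a1 + icost a2).+1
  end.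

Fixpoint rcost (a : rexp) : nat :=
  match a with
  | RConst _ | RVar _ => 1
  | RGet _ i => (icost i).+1
  | RBin _ a1 a2 => (rcost a1 + rcost a2).+1
  end.

Fixpoint bcost (b : bexp) : nat :=
  match b with
  | BIle a1 a2 => (icost a1 + icost a2).+1
  | BRle a1 a2 => (rcost a1 + rcost a2).+1
  | BNot b1 => (bcost b1).+1
  | BAnd b1 b2 => (bcost b1 + bcost b2).+1
  end.

Section Semantics.
Variables (R : realType) (B : nat).

Record state := State {
  ivar : nat -> nat;
  iarr : nat -> nat -> nat;
  rvar : nat -> R;
  rarr : nat -> nat -> R }.

Definition upd (X : Type) (f : nat -> X) (i : nat) (v : X) : nat -> X :=
  fun j => if j == i then v else f j.

Definition set_ivar s x v := State (upd (ivar s) x v) (iarr s) (rvar s) (rarr s).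
Definition set_iarr s a i v :=
  State (ivar s) (upd (iarr s) a (upd (iarr s a) i v)) (rvar s) (rarr s).
Definition set_rvar s x v := State (ivar s) (iarr s) (upd (rvar s) x v) (rarr s).
Definition set_rarr s a i v :=
  State (ivar s) (iarr s) (rvar s) (upd (rarr s) a (upd (rarr s a) i v)).

Definition word (v : nat) : option nat := if (v < B)%N then Some v else None.

Definition iop_eval (o : iop) (m n : nat) : option nat :=
  match o with
  | IAdd => word (m + n)
  | ISub => word (m - n)
  | IMul => word (m * n)
  | IDiv => if n == 0%N then None else word (m %/ n)
  | IMod => if n == 0%N then None else word (m %% n)
  end.

Definition rop_eval (o : rop) (x y : R) : option R :=
  match o with
  | RAdd => Some (x + y)
  | RSub => Some (x - y)
  | RMul => Some (x * y)
  | RDiv => if y == 0 then None else Some (x / y)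
  end.

Definition obind2 (X Y Z : Type) (f : X -> Y -> option Z)
    (x : option X) (y : option Y) : option Z :=
  obind (fun x => obind (f x) y) x.

Fixpoint ieval (s : state) (a : iexp) : option nat :=
  match a with
  | IConst c => word c
  | IVar x => word (ivar s x)
  | IGet b i => obind (fun j => word (iarr s b j)) (ieval s i)
  | IBin o a1 a2 => obind2 (iop_eval o) (ieval s a1) (ieval s a2)
  end.

Fixpoint reval (s : state) (a : rexp) : option R :=
  match a with
  | RConst c => Some c%:R
  | RVar x => Some (rvar s x)
  | RGet b i => omap (rarr s b) (ieval s i)
  | RBin o a1 a2 => obind2 (rop_eval o) (reval s a1) (reval s a2)
  end.

Fixpoint beval (s : state) (b : bexp) : option bool :=
  match b with
  | BIle a1 a2 => obind2 (fun m n => Some (m <= n)%N) (ieval s a1) (ieval s a2)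
  | BRle a1 a2 => obind2 (fun x y => Some (x <= y)) (reval s a1) (reval s a2)
  | BNot b1 => omap negb (beval s b1)
  | BAnd b1 b2 => obind2 (fun p q => Some (p && q)) (beval s b1) (beval s b2)
  end.

(* [exec c s t s']: started in [s], the program [c] halts in [s'] after [t]
   elementary steps. Nothing is derivable for a program that diverges or that
   evaluates an undefined expression. *)
Inductive exec : cmd -> state -> nat -> state -> Prop :=
  | exec_skip s : exec Skip s 1 s
  | exec_iset s x a v : ieval s a = Some v ->
      exec (ISet x a) s (icost a).+1 (set_ivar s x v)
  | exec_iput s b i a j v : ieval s i = Some j -> ieval s a = Some v ->
      exec (IPut b i a) s (icost i + icost a).+1 (set_iarr s b j v)
  | exec_rset s x a v : reval s a = Some v ->
      exec (RSet x a) s (rcost a).+1 (set_rvar s x v)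
  | exec_rput s b i a j v : ieval s i = Some j -> reval s a = Some v ->
      exec (RPut b i a) s (icost i + rcost a).+1 (set_rarr s b j v)
  | exec_seq c1 c2 s s1 s2 t1 t2 : exec c1 s t1 s1 -> exec c2 s1 t2 s2 ->
      exec (Seq c1 c2) s (t1 + t2) s2
  | exec_if b c1 c2 s s1 t p : beval s b = Some p ->
      exec (if p then c1 else c2) s t s1 ->
      exec (If b c1 c2) s (bcost b + t).+1 s1
  | exec_while_false b c s : beval s b = Some false ->
      exec (While b c) s (bcost b).+1 s
  | exec_while_true b c s s1 s2 t1 t2 : beval s b = Some true ->
      exec c s t1 s1 -> exec (While b c) s1 t2 s2 ->
      exec (While b c) s (bcost b + t1 + t2).+1 s2.

Lemma exec_det c s t1 s1 t2 s2 :
  exec c s t1 s1 -> exec c s t2 s2 -> t1 = t2 /\ s1 = s2.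
Proof.
move=> H; elim: H t2 s2 => {c s t1 s1} [s|s x a v E|s b i a j v E F|s x a v E
  |s b i a j v E F|c1 c2 s u1 u2 t1 t2 _ IH1 _ IH2|b c1 c2 s u t p E _ IH
  |b c s E|b c s u1 u2 t1 t2 E _ IH1 _ IH2] t' s' H; inversion H; subst;
  try (split; congruence).
- have [? ?] := IH1 _ _ ltac:(eassumption); subst.
  by have [? ?] := IH2 _ _ ltac:(eassumption); subst.
- have ? : p = p0 by congruence.
  by subst; have [? ?] := IH _ _ ltac:(eassumption); subst.
- have [? ?] := IH1 _ _ ltac:(eassumption); subst.
  by have [? ?] := IH2 _ _ ltac:(eassumption); subst.
Qed.

End Semantics.

(** * Input and output conventions *)

Section InputOutput.
Variables (R : realType) (n : nat).

(* The neighbours of each vertex, in an arbitrary order. *)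
Definition adjacency_lists (e : rel 'I_n) (adj : 'I_n -> seq 'I_n) : Prop :=
  forall x, uniq (adj x) /\ adj x =i e x.

(* The adjacency lists are stored one after the other in integer array 1, the
   list of [x] at the indices from [iarr 0 x] to [(iarr 0 x.+1).-1]; integer
   variable 0 holds the number of vertices, and real array 0 the weights.
   All remaining memory is zero. *)
Definition input (adj : 'I_n -> seq 'I_n) (w : 'I_n -> R) : state R :=
  let lists := [seq [seq val y | y <- adj x] | x <- enum 'I_n] in
  State
    (upd (fun=> 0%N) 0 n)
    (upd (upd (fun=> fun=> 0%N)
      0 (fun i => if (i <= n)%N then size (flatten (take i lists)) else 0%N))
      1 (nth 0%N (flatten lists)))
    (fun=> 0)
    (upd (fun=> fun=> 0) 0 (fun i => oapp w 0 (insub i))).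

(* Integer variable 1 holds the cardinality of [A], and integer array 2 starts
   with the list, in some order and without repetition, of the elements of
   [A]. *)
Definition outputs (s : state R) (A : {set 'I_n}) : Prop :=
  perm_eq (mkseq (iarr s 2) (ivar s 1)) [seq val x | x <- enum A].

End InputOutput.

(* Main.v *)
Require Import Defs.
From mathcomp Require Import all_boot all_order all_algebra.
From mathcomp Require Import reals zify ring.

(* Root the graph at a vertex [r] and order the vertices by a breadth first
   search. Going down along an edge, one leaves a halfspace not containing [r],
   and every such halfspace [H] has a unique first vertex, its gate, whose
   position is the class of all edges crossing [H]. A vertex with one parent is
   a gate. If [u] has several parents, let [a] be the largest class of an edge
   going down from [u], say to [v]: then [a] is also the largest class going
   down from every other parent of [u], while all classes going down from [v]
   are smaller. So, with [v] taken as the father of [u], the class of the father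
   edge of [u] is the maximum of those of its parents, and [v] is the parent at
   which that number is smallest; no square of the graph has to be found.
   The path of fathers from a vertex [z] to [r] crosses [H] once if [z] is in
   [H] and never otherwise. Hence the weight of [H] is the sum of the weights
   of the subtrees hanging from the father edges in its class, and one bottom-up
   pass computes all of them. Along a father edge of class [c] the median
   function changes by the total weight minus twice the weight of [c], so a
   top-down pass computes it up to a constant, and the minimum is read off. *)

Set Implicit Arguments.
Unset Strict Implicit.
Unset Printing Implicit Defensive.

Import Order.TTheory GRing.Theory Num.Theory.

(** * Halfspaces of median graphs *)

Section Distance.
Variables (T : finType) (e : rel T).
Hypothesis Ge : connected_simple_graph e.
Local Notation d := (gdist e).

Lemma walkP k x y :
  reflect (exists p : seq T, [/\ size p = k, path e x p & last x p = y])
    (walk e k x y).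
Proof.
apply: (iffP existsP) => [[p /andP [ep /eqP lp]]|[p [sp ep lp]]].
  by exists p; rewrite size_tuple.
by rewrite -sp; exists (in_tuple p); rewrite ep lp /=.
Qed.

Lemma gdist_walk x y : walk e (d x y) x y.
Proof. by case: Ge => _ _ _ /(_ x y) /gdistP []. Qed.

Lemma gdist_min x y k : walk e k x y -> d x y <= k.
Proof. by case: Ge => _ _ _ /(_ x y) /gdistP [_ H]; exact: H. Qed.

Lemma gdist0 x : d x x = 0.
Proof. by apply/eqP; rewrite -leqn0; apply/gdist_min/walkP; exists [::]. Qed.

Lemma gdist_eq0 x y : d x y = 0 -> x = y.
Proof.
by move=> d0; have := gdist_walk x y; rewrite d0 => /walkP [[|z p] []].
Qed.

Lemma gdist_triangle y x z : d x z <= d x y + d y z.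
Proof.
have /walkP [p [sp ep lp]] := gdist_walk x y.
have /walkP [q [sq eq lq]] := gdist_walk y z.
apply/gdist_min/walkP; exists (p ++ q).
by rewrite size_cat sp sq cat_path last_cat lp ep eq.
Qed.

Lemma gdistC x y : d x y = d y x.
Proof.
case: Ge => es _ _ _.
suff le a b : d a b <= d b a by apply/eqP; rewrite eqn_leq !le.
have /walkP [p [sp ep lp]] := gdist_walk b a.
apply/gdist_min/walkP; exists (rev (belast b p)); split.
- by rewrite size_rev size_belast.
- by rewrite -lp rev_path -(eq_path es).
- by case: p sp ep lp => [|c p] /= _ _ lp //; rewrite rev_cons last_rcons.
Qed.

Lemma gdist1 x y : e x y -> d x y = 1.
Proof.
case: Ge => _ ei _ _ exy; apply/eqP; rewrite eqn_leq; apply/andP; split.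
  by apply/gdist_min/walkP; exists [:: y]; rewrite /= exy.
rewrite lt0n; apply/eqP => /gdist_eq0 xy.
by move: exy; rewrite xy ei.
Qed.

Lemma gdist_step x y : x != y -> exists2 z, e x z & d x y = (d z y).+1.
Proof.
move=> nxy; have /walkP [[|z p] [/= sp]] := gdist_walk x y.
  by move=> _ xy; rewrite xy eqxx in nxy.
move=> /andP [exz ep] lp; exists z => //.
have le1 : d z y <= size p by apply/gdist_min/walkP; exists p.
have := gdist_triangle z x y; rewrite (gdist1 exz); lia.
Qed.

Lemma gdist1_edge x y : d x y = 1 -> e x y.
Proof.
move=> d1; have nxy : x != y by apply/eqP => xy; rewrite xy gdist0 in d1.
by have [z exz] := gdist_step nxy; rewrite d1 => -[/esym /gdist_eq0 <-].
Qed.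

End Distance.

(** * Bipartiteness, squares and convexity of halfspaces *)

Section Median.
Variables (T : finType) (e : rel T).
Hypothesis Me : median_graph e.
Local Notation d := (gdist e).

Let Ge : connected_simple_graph e. Proof. by case: Me. Qed.

Lemma median_ex x y z : exists m,
  [/\ d x m + d m y = d x y, d y m + d m z = d y z & d z m + d m x = d z x].
Proof.
case: Me => _ /(_ x y z) /eqP /cards1P [m Em].
have: m \in [set m] by rewrite inE.
rewrite -Em !inE => /andP [/andP [/eqP ? /eqP ?] /eqP ?].
by exists m.
Qed.

Lemma median_uniq x y z m m' :
  d x m + d m y = d x y -> d y m + d m z = d y z -> d z m + d m x = d z x ->
  d x m' + d m' y = d x y -> d y m' + d m' z = d y z ->
  d z m' + d m' x = d z x -> m = m'.
Proof.
case: Me => _ /(_ x y z) /eqP /cards1P [c Ec] *.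
have : m \in [set c] by rewrite -Ec !inE; lia.
have : m' \in [set c] by rewrite -Ec !inE; lia.
by rewrite !inE => /eqP -> /eqP ->.
Qed.

(** The median of [z] and the two ends of an edge must be one of the ends; in particular the graph
    is bipartite. *)
Lemma edge_dist z x y : e x y -> d z x = (d z y).+1 \/ d z y = (d z x).+1.
Proof.
move=> exy; have [m [h1 h2 h3]] := median_ex z x y.
have d1 := gdist1 Ge exy.
have [mx|/gdist_eq0 ym] : d x m = 0 \/ d m y = 0 by lia.
- move: h1 h2 h3; rewrite -(gdist_eq0 Ge mx) (gdistC Ge y x) (gdistC Ge y z).
  rewrite (gdistC Ge x z) d1; lia.
- move: h1 h2 h3; rewrite (ym Ge) (gdistC Ge y x) (gdistC Ge y z) d1; lia.
Qed.

Definition halfspace (u v : T) : {set T} := [set z | d z u < d z v].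

Lemma in_halfspace z u v : (z \in halfspace u v) = (d z u < d z v).
Proof. by rewrite inE. Qed.

Lemma halfspaceC u v : e u v -> halfspace v u = ~: halfspace u v.
Proof.
move=> euv; apply/setP => z; rewrite !inE.
by case: (edge_dist z euv); lia.
Qed.

Lemma e_sym x y : e x y -> e y x.
Proof. by case: Ge => es _ _ _; rewrite es. Qed.

(** Suppose [z] is on the side of [p] for one edge but on that of [q'] for the other. Then [q] and
    [p'] are one step farther from [z] than [p] and [q'], and the median [r] of [z], [p], [q'] is a
    common neighbour of [p] and [q'] one step nearer. Now [p] and [q'] are both medians of [q],
    [p'], [r], hence equal, which is excluded. *)
Lemma square_opp_sub p q p' q' : p != q' -> q != p' ->
  e p q -> e p p' -> e p' q' -> e q q' ->
  halfspace p q \subset halfspace p' q'.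
Proof.
move=> npq nqp epq epp epq' eqq; apply/subsetP => z; rewrite !in_halfspace => lt.
case: (edge_dist z epq) => [|zq]; first by lia.
case: (edge_dist z epq') => [zp'|]; last by lia.
have Hq' : d z q' = d z p.
  by case: (edge_dist z epp); case: (edge_dist z eqq); lia.
have dpq' : d p q' = 2.
  have := edge_dist p epq'; have := gdist_triangle Ge p' p q'.
  rewrite !(gdist1 Ge epp) !(gdist1 Ge epq') => *.
  suff : d p q' != 0 by lia.
  by apply/eqP => /(gdist_eq0 Ge) E; rewrite E eqxx in npq.
have dqp' : d q p' = 2.
  have := edge_dist q epp; have := gdist_triangle Ge p q p'.
  rewrite (gdistC Ge q p) !(gdist1 Ge epp) !(gdist1 Ge epq) => *.
  suff : d q p' != 0 by lia.
  by apply/eqP => /(gdist_eq0 Ge) E; rewrite E eqxx in nqp.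
have [r [h1 h2 h3]] := median_ex z p q'.
rewrite (gdistC Ge q' z) in h3; rewrite (gdistC Ge p r) (gdistC Ge q' r) in h1 h2 h3.
have dpr : e p r by apply: (gdist1_edge Ge); rewrite (gdistC Ge); have := gdistC Ge r z; lia.
have dqr : e q' r by apply: (gdist1_edge Ge); rewrite (gdistC Ge); have := gdistC Ge r z; lia.
have zr : (d z r).+1 = d z p.
  by have := gdist1 Ge dpr; rewrite (gdistC Ge); lia.
have far a : d z a = (d z p).+1 -> e p a -> d r a = 2.
  move=> za epa; have := edge_dist r epa; have := gdist_triangle Ge p r a.
  have := gdist_triangle Ge r z a.
  have := gdist1 Ge dpr; have := gdist1 Ge epa; rewrite (gdistC Ge r p); lia.
have rq := far _ zq epq.
have rp' : d r p' = 2 by apply: far => //; lia.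
suff E : p = q' by rewrite E eqxx in npq.
have := gdist1 Ge dpr; have := gdist1 Ge dqr; have := gdist1 Ge epq.
have := gdist1 Ge epp; have := gdist1 Ge epq'; have := gdist1 Ge eqq.
have := gdistC Ge p r; have := gdistC Ge q' r; have := gdistC Ge p q.
have := gdistC Ge p p'; have := gdistC Ge p' q'; have := gdistC Ge q q'.
have := gdistC Ge r p'; have := gdistC Ge r q.
by move=> *; apply: (@median_uniq q p' r); lia.
Qed.

Lemma square_opp p q p' q' : p != q' -> q != p' ->
  e p q -> e p p' -> e p' q' -> e q q' ->
  halfspace p q = halfspace p' q'.
Proof.
move=> n1 n2 *; apply/eqP; rewrite eqEsubset; apply/andP; split.
  exact: square_opp_sub.
by apply: square_opp_sub => //; rewrite 1?eq_sym //; apply: e_sym.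
Qed.

(** Induction on the distance from [p] to [u]. With [p'] the next vertex from [p] towards [u] and
    [q'] the median of [p'], [q], [v], the edge [p q] is opposite in a square to [p' q'], which
    crosses the same halfspace closer to [u]. *)
Lemma halfspace_crossing u v p q : e u v -> e p q ->
  p \in halfspace u v -> q \notin halfspace u v ->
  halfspace p q = halfspace u v.
Proof.
move=> euv.
move Ek : (d p u) => k; elim: k p q Ek => [|k IH] p q pu epq; rewrite !in_halfspace.
  move: (gdist_eq0 Ge pu) => pu' _; rewrite {p pu}pu' in epq *.
  have := gdist1 Ge epq; rewrite (gdistC Ge) => qu nlt.
  suff -> : q = v by [].
  by apply: (gdist_eq0 Ge); have := edge_dist q euv; lia.
move=> pv qv.
have Euv := edge_dist _ euv.
have Hp := Euv p; have Hq := Euv q.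
have Hu := edge_dist u epq; have Hv := edge_dist v epq.
rewrite !(gdistC Ge u) in Hu; rewrite !(gdistC Ge v) in Hv.
have quE : d q u = k.+2 by lia.
have qvE : d q v = k.+1 by lia.
have nup : p != u by apply/eqP => E; rewrite E gdist0 in pu.
have [p' epp'] := gdist_step Ge nup; rewrite pu => -[p'u].
have Hp' := Euv p'; have := gdist_triangle Ge p' p v.
rewrite (gdist1 Ge epp') => tri.
have p'v : d p' v = k.+1 by lia.
have qp' : q != p' by apply/eqP => E; rewrite E in quE; lia.
have dqp' : d q p' = 2.
  have := edge_dist q epp'; have := gdist_triangle Ge p q p'.
  rewrite (gdistC Ge q p) (gdist1 Ge epp') (gdist1 Ge epq) => *.
  suff : d q p' != 0 by lia.
  by apply/eqP => /(gdist_eq0 Ge) E; rewrite E eqxx in qp'.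
have [q' [h1 h2 h3]] := median_ex p' q v.
have c1 := gdistC Ge p' q; have c2 := gdistC Ge q q'; have c3 := gdistC Ge v q'.
have c4 := gdistC Ge p' q'; have c5 := gdistC Ge v p'.
have ep'q' : e p' q' by apply: (gdist1_edge Ge); lia.
have eqq' : e q q' by apply: (gdist1_edge Ge); lia.
have q'v : d q' v = k by have := gdist1 Ge eqq'; lia.
have pq' : p != q' by apply/eqP => E; rewrite E in pv; rewrite E in pu; lia.
rewrite (square_opp pq' qp' epq epp' ep'q' eqq').
apply: IH => //; rewrite ?in_halfspace; first by lia.
have := gdist_triangle Ge q' q u; rewrite (gdist1 Ge eqq').
by have := Euv q'; lia.
Qed.

Lemma geodesic_crossing (A : {set T}) x m : x \in A -> m \notin A ->
  exists p q, [/\ e p q, p \in A, q \notin A,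
    d x q = (d x p).+1 & d x m = d x q + d q m].
Proof.
move Ek : (d x m) => k; elim: k x Ek => [|k IH] x xm xA mA.
  by move: xA mA; rewrite (gdist_eq0 Ge xm) => ->.
have nxm : x != m by apply/eqP => E; rewrite E gdist0 in xm.
have [z exz] := gdist_step Ge nxm; rewrite xm => -[/esym zm].
have xz := gdist1 Ge exz.
case zA: (z \in A); last first.
  by exists x, z; rewrite gdist0 // xz zm add1n zA.
have [p [q [epq pA qA zq zqm]]] := IH _ zm zA mA.
exists p, q; split => //.
  have := gdist_triangle Ge z x q; have := gdist_triangle Ge z x p.
  have := gdist_triangle Ge q x m; have := edge_dist x epq.
  have := gdist_triangle Ge p x q; rewrite (gdist1 Ge epq).
  lia.
have := gdist_triangle Ge z x q; have := gdist_triangle Ge q x m; lia.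
Qed.

(** A geodesic from [x] to [y] through an outside vertex [m] leaves the halfspace by an edge [p q].
    By [halfspace_crossing] this edge bounds the same halfspace, so [y] is nearer to [p] than to
    [q], although [q] comes after [p] on the geodesic. *)
Lemma halfspace_convex u v x y m : e u v ->
  x \in halfspace u v -> y \in halfspace u v ->
  d x m + d m y = d x y -> m \in halfspace u v.
Proof.
move=> euv xH yH xmy; apply/negPn/negP => mH.
have [p [q [epq pH qH xq xqm]]] := geodesic_crossing xH mH.
move: yH; rewrite -(halfspace_crossing euv epq pH qH) in_halfspace => lt.
have := gdist_triangle Ge q y m; have := gdist_triangle Ge p x y.
have := gdist_triangle Ge m q y.
have := gdistC Ge y p; have := gdistC Ge y q; lia.
Qed.

Lemma parent_exists r u : u != r -> exists2 v, e u v & d r v < d r u.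
Proof.
move=> nur; have [v euv E] := gdist_step Ge nur.
by exists v => //; rewrite !(gdistC Ge r); lia.
Qed.

End Median.

(** * Gates, keys of edge classes, and the recursion that computes them *)

Section Classes.
Variables (T : finType) (e : rel T).
Hypothesis Me : median_graph e.
Variables (r : T) (pos : T -> nat).
Hypothesis pos_inj : injective pos.
Hypothesis pos_dist : forall x y, pos x < pos y -> gdist e r x <= gdist e r y.
Local Notation d := (gdist e).
Local Notation H := (halfspace e).

Let Ge : connected_simple_graph e. Proof. by case: Me. Qed.

Definition parent u v := e u v && (d r v < d r u).

(** When [parent u v] holds, [H u v] is the side away from [r]; its first vertex is also the metric
    projection of [r] on it, see [gate_interval]. *)
Definition gate u v := [arg min_(x < u | x \in H u v) pos x].

(** By [key_ext] and [key_inj], two edges going down have the same key exactly when they bound the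
    same halfspace, so the key is a numeric name for the class. *)
Definition key u v := pos (gate u v).

Lemma parent_dist u v : parent u v -> d r u = (d r v).+1.
Proof. by case/andP => euv; case: (edge_dist Me r euv); lia. Qed.

Lemma parent_pos u v : parent u v -> pos v < pos u.
Proof.
move=> /parent_dist E; rewrite ltnNge leq_eqVlt; apply/negP => /orP [/eqP /pos_inj uv|].
  by rewrite uv in E; lia.
by move/pos_dist; lia.
Qed.

Lemma root_parentN v : ~~ parent r v.
Proof. by rewrite /parent gdist0 // ltn0 andbF. Qed.

Lemma parent_edge u v : parent u v -> e u v. Proof. by case/andP. Qed.
Hint Resolve parent_edge : core.

Lemma parent_head u v : parent u v -> u \in H u v.
Proof. by case/andP => euv _; rewrite in_halfspace gdist0 // (gdist1 Ge euv). Qed.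

Lemma parent_tail u v : parent u v -> v \notin H u v.
Proof. by move=> _; rewrite in_halfspace gdist0. Qed.

Lemma parent_root u v : parent u v -> r \notin H u v.
Proof. by case/andP => _; rewrite in_halfspace; lia. Qed.
Hint Resolve parent_head parent_tail parent_root : core.

Lemma parent_crossing a b u v : parent a b -> parent u v ->
  u \in H a b -> v \notin H a b -> H u v = H a b.
Proof. by move=> ab uv; apply: halfspace_crossing; auto. Qed.

(** If the edge entered [H a b] on its way down, [H v u] would be equal to [H a b]; but [H v u]
    contains [r], as [v] is nearer to [r] than [u]. *)
Lemma parent_mono a b u v : parent a b -> parent u v ->
  v \in H a b -> u \in H a b.
Proof.
move=> ab uv vH; apply/negPn/negP => uH.
have evu : e v u by apply: (e_sym Me); auto.
have := parent_root ab.
rewrite -(halfspace_crossing Me (parent_edge ab) evu vH uH) in_halfspace.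
by rewrite (parent_dist uv) ltnS leqnn.
Qed.

Lemma gateP u v : parent u v ->
  gate u v \in H u v /\ forall x, x \in H u v -> pos (gate u v) <= pos x.
Proof. by rewrite /gate => uv; case: arg_minnP => //; auto. Qed.

Lemma key_ext u v u' v' : parent u v -> parent u' v' -> H u v = H u' v' ->
  key u v = key u' v'.
Proof.
move=> /gateP [g1 m1] /gateP [g2 m2] E; apply/eqP; rewrite /key eqn_leq.
by rewrite m1 ?m2 // -?E // E.
Qed.

(** A parent of the gate precedes it in the order, so it lies outside the halfspace and the edge
    crosses. *)
Lemma gate_parent u v y : parent u v -> parent (gate u v) y ->
  H (gate u v) y = H u v.
Proof.
move=> uv gy; have [gH gm] := gateP uv.
apply: parent_crossing => //; apply/negP => /gm.
by rewrite leqNgt (parent_pos gy).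
Qed.

Lemma parent_ex u : u != r -> exists v, parent u v.
Proof. by move=> /(parent_exists Me) [v euv lt]; exists v; rewrite /parent euv. Qed.

Lemma gate_neq_root u v : parent u v -> gate u v != r.
Proof.
move=> uv; have [gH _] := gateP uv; apply: contraNneq (parent_root uv).
by move=> <-.
Qed.

(** The gate determines the halfspace, since any edge going down from the gate bounds it. *)
Lemma key_inj u v u' v' : parent u v -> parent u' v' ->
  key u v = key u' v' -> H u v = H u' v'.
Proof.
move=> uv uv' /pos_inj E; have [y gy] := parent_ex (gate_neq_root uv).
by rewrite -(gate_parent uv gy) E (gate_parent uv') // -E.
Qed.

(** Convexity puts the median of [r], [x] and the gate into the halfspace. It is no farther from [r]
    than the gate, while the gate comes first in an order sorted by distance; so it is the gate. *)
Lemma gate_interval u v x : parent u v -> x \in H u v ->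
  d r x = d r (gate u v) + d (gate u v) x.
Proof.
move=> uv xH; have [gH gm] := gateP uv.
have [m [h1 h2 h3]] := median_ex Me r x (gate u v).
have mH : m \in H u v by apply: (halfspace_convex Me _ xH gH); auto.
have c1 := gdistC Ge m (gate u v); have c2 := gdistC Ge m r.
have c3 := gdistC Ge (gate u v) r; have c4 := gdistC Ge x (gate u v).
have c5 := gdistC Ge x m.
suff E : d r (gate u v) <= d r m.
  have /(gdist_eq0 Ge) -> : d (gate u v) m = 0 by lia.
  by rewrite h1.
move: (gm _ mH); rewrite leq_eqVlt => /orP [/eqP /pos_inj ->//|].
exact: pos_dist.
Qed.

(** If the gate were not [u], the first step from [u] towards it would stay in the halfspace by
    convexity and go down by [gate_interval]. That would be a second parent, as [v] is outside. *)
Lemma key_single_parent u v : parent u v -> (forall v', parent u v' -> v' = v) ->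
  key u v = pos u.
Proof.
move=> uv one; have [gH gm] := gateP uv; rewrite /key.
case: (altP (u =P gate u v)) => [<-//|nug].
have [x eux ux] := gdist_step Ge nug.
have c1 := gdistC Ge x (gate u v); have c2 := gdistC Ge u (gate u v).
have xu := gdist1 Ge eux; have xu' := gdistC Ge u x.
have xH : x \in H u v.
  by apply: (halfspace_convex Me _ gH (parent_head uv)); auto; lia.
have px : parent u x.
  rewrite /parent eux (gate_interval uv (parent_head uv)) (gate_interval uv xH).
  by lia.
by move: xH; rewrite (one _ px) (negPf (parent_tail uv)).
Qed.

(* When the gate of [H u v] is outside [H v y], the median of that gate, [u] and
   [y] is the required [y']. *)
Lemma key_new u v y : parent u v -> parent v y ->
  (exists2 y', parent u y' & H u y' = H v y) \/ key v y < key u v.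
Proof.
move=> uv vy; have [gH gm] := gateP uv.
have uc : u \in H v y by apply: parent_mono uv _ => //; auto.
have yb : y \notin H u v.
  by apply: contra (parent_tail uv) => yb; apply: (parent_mono uv vy).
case gc: (gate u v \in H v y).
  right; have [_ gm'] := gateP vy; have := gm' _ gc; rewrite leq_eqVlt => /orP [|//].
  move=> /eqP E; have EH := key_inj vy uv E.
  by have := parent_tail uv; rewrite -EH parent_head.
left; have [z [h1 h2 h3]] := median_ex Me u y (gate u v).
have evy := parent_edge vy; have evyC := e_sym Me evy.
have EC := halfspaceC Me evy.
have zc : z \notin H v y.
  rewrite -in_setC -EC; apply: (halfspace_convex Me evyC _ _ h2).
    by rewrite EC in_setC; auto.
  by rewrite EC in_setC gc.
have zb : z \in H u v.
  apply: (halfspace_convex Me _ gH (parent_head uv) h3); auto.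
have duy : d u y <= 2.
  have := gdist_triangle Ge v u y.
  by rewrite (gdist1 Ge evy) (gdist1 Ge (parent_edge uv)).
have uz : d u z != 0.
  by apply/eqP => /(gdist_eq0 Ge) E; rewrite -E uc in zc.
have zy : d z y != 0.
  by apply/eqP => /(gdist_eq0 Ge) E; rewrite E (negPf yb) in zb.
have euz : e u z by apply: (gdist1_edge Ge); lia.
have EH : H u z = H v y by apply: halfspace_crossing.
exists z => //; rewrite /parent euz /=.
have := parent_root vy; rewrite -EH in_halfspace.
by have := edge_dist Me r euz; lia.
Qed.

(** The median of [r], [v] and [v'] is a common parent of [v] and [v']; it closes a square in which
    its edge to [v'] is opposite to [u v]. *)
Lemma parent_square u v v' : parent u v -> parent u v' -> v != v' ->
  exists2 x, parent v' x & H v' x = H u v.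
Proof.
move=> uv uv' nvv'; have [x [h1 h2 h3]] := median_ex Me r v v'.
have E := parent_dist uv; have E' := parent_dist uv'.
have euv := parent_edge uv; have euv' := parent_edge uv'.
have duv := gdist1 Ge euv; have duv' := gdist1 Ge euv'.
have c1 := gdistC Ge u v; have c2 := gdistC Ge r v'; have c3 := gdistC Ge r x.
have c4 := gdistC Ge v x; have c5 := gdistC Ge v' x.
have dvv' : d v v' = 2.
  have := gdist_triangle Ge u v v'.
  have := edge_dist Me v euv'.
  suff : d v v' != 0 by lia.
  by apply/eqP => /(gdist_eq0 Ge) /eqP; apply/negP.
have evx : e v x by apply: (gdist1_edge Ge); lia.
have evx' : e v' x by apply: (gdist1_edge Ge); lia.
exists x; first by rewrite /parent evx'; lia.
apply/esym/(square_opp Me) => //.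
by apply/eqP => ux; rewrite ux in E; lia.
Qed.

(** The rule by which the program fills in classes and fathers, free of any mention of halfspaces.
    The root, having no parent, falls under [cl_single]. *)
Variables (cl : T -> nat) (fa : T -> T).
Hypothesis fa_parent : forall u, u != r -> parent u (fa u).
Hypothesis fa_min : forall u p, u != r -> parent u p -> cl (fa u) <= cl p.
Hypothesis cl_single : forall u,
  (forall p p', parent u p -> parent u p' -> p = p') -> cl u = pos u.
Hypothesis cl_max : forall u p p', parent u p -> parent u p' -> p != p' ->
  (exists2 q, parent u q & cl u = cl q) /\ forall q, parent u q -> cl q <= cl u.

(* If [a] is the largest key of an edge going down from [u], towards [v], then
   every other parent of [u] has an edge of key [a] and none of larger key,
   whereas all keys at [v] are smaller than [a]. *)
Lemma cl_key u : u != r ->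
  cl u = key u (fa u) /\ forall p, parent u p -> key u p <= cl u.
Proof.
move Ek : (d r u) => k; elim: k u Ek => [|k IH] u ru nur.
  by move: nur; rewrite -(gdist_eq0 Ge ru) eqxx.
have pu := fa_parent nur.
have [one|] := boolP [forall p, parent u p ==> (p == fa u)].
  have {}one p : parent u p -> p = fa u.
    by move=> up; apply/eqP; move/forallP/(_ p)/implyP: one; apply.
  rewrite cl_single => [|p p' /one -> /one ->//].
  by rewrite (key_single_parent pu one); split=> // p /one ->; rewrite key_single_parent.
rewrite negb_forall => /existsP [p]; rewrite negb_imply => /andP [up npu].
set vs := [arg max_(v > p | parent u v) key u v].
have [uvs vs_max] : parent u vs /\ forall v, parent u v -> key u v <= key u vs.
  by rewrite /vs; case: arg_maxnP.
(* All parents of [u] are on one level: if one of two distinct parents were [r], the other would be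
   at distance 0 from [r] as well. *)
have nroot v v' : parent u v -> parent u v' -> v' != v -> v != r.
  move=> uv uv'; apply: contraNneq => vr.
  have := parent_dist uv; have := parent_dist uv'; rewrite vr gdist0 // => -> [] E.
  by rewrite -(gdist_eq0 Ge E).
have level v : parent u v -> d r v = k by move/parent_dist; lia.
have [v1 uv1 nv1] : exists2 v1, parent u v1 & v1 != vs.
  have [Ep|] := eqVneq p vs; last by exists p.
  by exists (fa u); rewrite // -Ep eq_sym.
have key_other v : parent u v -> v != vs -> cl v = key u vs.
  move=> uv nv; have nvr : v != r by apply: nroot uv uvs _; rewrite eq_sym.
  have [Ev mv] := IH _ (level _ uv) nvr.
  apply/eqP; rewrite eqn_leq; apply/andP; split.
    have pv := fa_parent nvr; rewrite Ev.
    have [[y uy /(key_ext uy pv) <-]|lt] := key_new uv pv; first exact: vs_max.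
    exact: leq_trans (ltnW lt) (vs_max _ uv).
  have [|x vx /(key_ext vx uvs) <-] := parent_square uvs uv _; last exact: mv.
  by rewrite eq_sym.
have key_vs : cl vs < key u vs.
  have nvr : vs != r by apply: nroot uvs uv1 _.
  have [-> _] := IH _ (level _ uvs) nvr.
  have pv := fa_parent nvr.
  have [[y uy E]|//] := key_new uvs pv; rewrite -(key_ext uy pv E).
  rewrite ltn_neqAle vs_max // andbT; apply/eqP => /key_inj -/(_ uy uvs) E'.
  by have := parent_tail uvs; rewrite -E' E parent_head.
have Ecl : cl u = key u vs.
  have [[q uq Eq] m] := cl_max uv1 uvs nv1.
  (* The maximum is attained at some parent [q], and not at [vs], whose class is smaller than that
     of [v1]. *)
  have := m _ uv1; rewrite (key_other _ uv1 nv1) Eq.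
  have [->|nq _] := eqVneq q vs; first by lia.
  exact: key_other.
suff -> : fa u = vs by rewrite Ecl.
apply/eqP/negPn/negP => nf.
by have := fa_min nur uvs; rewrite (key_other _ pu nf); lia.
Qed.

Hypothesis pos_root : pos r = 0.

Lemma cl_root : cl r = 0.
Proof.
by rewrite cl_single // => p p' rp; have := root_parentN p; rewrite rp.
Qed.

(** No gate is the root, and only the root has position 0; so class 0 is reserved for the root, and
    the program collects the total weight there. *)
Lemma cl_eq0 u : (cl u == 0) = (u == r).
Proof.
apply/eqP/eqP => [|->]; last exact: cl_root.
move=> E; apply/eqP/negPn/negP => nur; have [Ek _] := cl_key nur.
have := gate_neq_root (fa_parent nur); rewrite -(inj_eq pos_inj) pos_root.
by rewrite -E Ek eqxx.
Qed.

(** An equation between numbers, made to be unfolded along paths of fathers: the father edge of [z]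
    leaves the halfspace exactly when it has the class of [u], and no father edge enters it. *)
Lemma halfspace_cut u z : u != r -> z != r ->
  (z \in H u (fa u)) = (fa z \in H u (fa u)) + (cl z == cl u) :> nat.
Proof.
move=> nu nz; have pu := fa_parent nu; have pz := fa_parent nz.
have [Eu _] := cl_key nu; have [Ez _] := cl_key nz.
have [E|nE] := eqVneq (cl z) (cl u).
  rewrite -(key_inj pz pu) -?Eu -?Ez //.
  by rewrite parent_head // (negPf (parent_tail _)).
rewrite addn0; congr nat_of_bool; apply/idP/idP; last exact: parent_mono.
move=> zH; apply/negPn/negP => fzH.
by move/eqP: nE; rewrite Eu Ez; apply; apply: key_ext => //; apply: parent_crossing.
Qed.

End Classes.

(** * Change of the median function along an edge *)

Section MedianFunction.
Local Open Scope ring_scope.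

(** Holds term by term: moving from [v] to [u] brings the vertices of [halfspace e u v] one step
    nearer and all others one step farther. *)
Lemma median_fun_edge (R : realType) (T : finType) (e : rel T) (w : T -> R) u v :
  median_graph e -> e u v ->
  median_fun e w u = median_fun e w v + \sum_z w z
    - 2 * \sum_(z in halfspace e u v) w z.
Proof.
move=> Me euv; have Ge : connected_simple_graph e by case: Me.
rewrite (big_mkcond (mem (halfspace e u v))) big_distrr /= -big_split /= -sumrB.
apply: eq_bigr => z _; rewrite in_halfspace !(gdistC Ge _ z).
case: (edge_dist Me z euv) => E.
  by rewrite E ltnNge leqnSn /= mulr0 subr0 -addn1 natrD mulrDr mulr1.
by rewrite E ltnSn -addn1 natrD mulrDr mulr1; ring.
Qed.

End MedianFunction.

(** * Breadth first search *)

Lemma mem_full_seq (T : finType) (q : seq T) :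
  uniq q -> size q = #|T| -> forall v, v \in q.
Proof.
move=> q_uniq q_size v.
have sub : {subset q <= enum T} by move=> x _; rewrite mem_enum.
have le : size (enum T) <= size q by rewrite -cardT q_size.
by have [_ ->] := uniq_min_size q_uniq sub le; rewrite mem_enum.
Qed.

Lemma mem_full_ord n (q : seq 'I_n) :
  uniq q -> size q = n -> forall v, v \in q.
Proof. by move=> q_uniq Eq; apply: mem_full_seq => //; rewrite card_ord. Qed.

Section BFS.
Variables (T : finType) (e : rel T) (r : T).
Hypothesis Ge : connected_simple_graph e.
Local Notation d := (gdist e).

(* [q] is the queue with the [h] dequeued vertices still in front, and [L] is
   one more than the level, with [0] for the vertices not yet discovered. *)
Record bfs_inv (h : nat) (q : seq T) (L : T -> nat) : Prop := BfsInv {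
  bfs_uniq : uniq q;
  bfs_head : 0 < size q /\ nth r q 0 = r;
  bfs_root : L r = 1;
  bfs_mem : forall v, (v \in q) = (0 < L v);
  bfs_le : forall i, i < size q -> L (nth r q i) <= i.+1;
  bfs_sorted : forall i j, i <= j -> j < size q -> L (nth r q i) <= L (nth r q j);
  bfs_pred : forall v, v \in q -> v != r ->
    exists p, [/\ e p v, p \in q & L v = (L p).+1];
  bfs_done : forall i y, i < h -> i < size q -> e (nth r q i) y ->
    y \in q /\ L y <= (L (nth r q i)).+1;
  bfs_last : h < size q -> forall v, v \in q -> L v <= (L (nth r q h)).+1 }.

Lemma bfs_init L : L r = 1 -> (forall v, v != r -> L v = 0) ->
  bfs_inv 0 [:: r] L.
Proof.
move=> Lr L0; split => //=.
- by move=> v; rewrite inE; case: (eqVneq v r) => [->|/L0 ->] //; rewrite Lr.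
- by move=> [|i] //= _; rewrite Lr.
- by move=> [|i] [|j].
- by move=> v; rewrite inE => /eqP ->; rewrite eqxx.
- by move=> _ v; rewrite inE => /eqP ->; rewrite leqnSn.
Qed.

(** The queue stays sorted because, by [bfs_last], no queued level exceeds that of the scanned
    vertex plus one, which is the level of [y]. *)
Lemma bfs_push h q L y L' : bfs_inv h q L -> h < size q -> y \notin q ->
  e (nth r q h) y -> L' y = (L (nth r q h)).+1 ->
  (forall v, v != y -> L' v = L v) -> bfs_inv h (rcons q y) L'.
Proof.
move=> [uq [q0 hq] Lr mq lq sq pq dq laq] hs yq ey Ly Lv.
have ne v : v \in q -> v != y by apply: contraTneq => ->.
have nthq i : i < size q -> nth r (rcons q y) i = nth r q i /\ L' (nth r q i) = L (nth r q i).
  by move=> lt; rewrite nth_rcons lt Lv //; apply/ne/mem_nth.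
have nthy : nth r (rcons q y) (size q) = y by rewrite nth_rcons ltnn eqxx.
have rq : r \in q by rewrite -hq mem_nth.
have [Nh Lh] := nthq _ hs.
split.
- by rewrite rcons_uniq yq.
- by rewrite size_rcons; have [-> _] := nthq _ q0.
- by rewrite Lv // ne.
- by move=> v; rewrite mem_rcons inE; case: (eqVneq v y) => [->|/Lv ->]; rewrite ?Ly ?mq.
- move=> i; rewrite size_rcons ltnS leq_eqVlt => /orP [/eqP ->|lt].
    by rewrite nthy Ly ltnS (leq_trans (lq _ hs)).
  by have [-> ->] := nthq _ lt; exact: lq.
- move=> i j ij; rewrite size_rcons ltnS leq_eqVlt => /orP [/eqP Ej|lt].
    subst j; rewrite nthy Ly; move: ij; rewrite leq_eqVlt => /orP [/eqP ->|lt].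
      by rewrite nthy Ly.
    by have [-> ->] := nthq _ lt; apply: laq => //; exact: mem_nth.
  have [-> ->] := nthq _ lt; have [-> ->] := nthq _ (leq_ltn_trans ij lt).
  exact: sq.
- move=> v; rewrite mem_rcons inE => /orP [/eqP ->|vq] nvr.
    exists (nth r q h); split=> //; first by rewrite mem_rcons inE mem_nth ?orbT.
    by rewrite Ly Lh.
  have [p [ep pq' E]] := pq v vq nvr.
  by exists p; rewrite mem_rcons inE pq' orbT !Lv ?ne.
- move=> i z ih; have lt := ltn_trans ih hs; have [-> ->] := nthq _ lt.
  move=> _ ez; have [zq lz] := dq i z ih lt ez.
  by rewrite mem_rcons inE zq orbT Lv // ne.
- move=> _ v; rewrite Nh Lh mem_rcons inE => /orP [/eqP ->|vq]; first by rewrite Ly.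
  by rewrite Lv ?ne //; apply: laq.
Qed.

Lemma bfs_next h q L : bfs_inv h q L -> h < size q ->
  (forall y, e (nth r q h) y -> y \in q /\ L y <= (L (nth r q h)).+1) ->
  bfs_inv h.+1 q L.
Proof.
move=> [uq hq Lr mq lq sq pq dq laq] hs nb; split => //.
  move=> i y; rewrite ltnS leq_eqVlt => /orP [/eqP -> _|]; [exact: nb|exact: dq].
by move=> hs' v vq; apply: leq_trans (laq hs v vq) _; rewrite ltnS sq.
Qed.

(** If the queue ran empty early, the discovered set would contain [r] and be closed under adjacency
    by [bfs_done], hence be everything by connectedness. *)
Lemma bfs_progress h q L : bfs_inv h q L -> h < #|T| -> h <= size q -> h < size q.
Proof.
move=> I lt; rewrite leq_eqVlt => /orP [/eqP E|//].
have {}lt : size q < #|T| by rewrite -E.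
have rq : r \in q by have [q0 hq] := bfs_head I; rewrite -hq mem_nth.
suff all v : v \in q.
  by move: lt; rewrite ltnNge cardT uniq_leq_size ?enum_uniq.
case: Ge => _ _ _ /(_ r v) /connectP [p ep ->].
elim: p r rq ep => [|z p IH] //= x xq /andP [exz ep].
apply: IH ep; have lx : index x q < size q by rewrite index_mem.
have [] // := bfs_done I (i := index x q) (y := z); first by rewrite E.
by rewrite nth_index.
Qed.

(** The upper bound follows a geodesic from [r] by [bfs_done]; for the lower one, [bfs_pred] gives a
    walk back to [r] with one edge per level. *)
Lemma bfs_level q L : bfs_inv #|T| q L -> size q = #|T| ->
  forall v, L v = (d r v).+1.
Proof.
move=> I sq.
have all := mem_full_seq (bfs_uniq I) sq.
move=> v; apply/eqP; rewrite eqn_leq; apply/andP; split.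
  move Ek : (d r v) => k; elim: k v Ek => [|k IH] v Ek.
    by rewrite -(gdist_eq0 Ge Ek) (bfs_root I).
  have nvr : v != r by apply/eqP => E; rewrite E gdist0 in Ek.
  have [p evp] := gdist_step Ge nvr; rewrite !(gdistC Ge _ r) Ek => -[Ep].
  have epv : e p v by case: Ge => es _ _ _; rewrite es.
  have lp : index p q < size q by rewrite index_mem.
  have [] // := bfs_done I (i := index p q) (y := v); rewrite ?nth_index //.
    by rewrite -sq.
  by move=> _ le; apply: leq_trans le _; rewrite ltnS IH.
move Ek : (L v) => k; elim: k v Ek => [|k IH] v Ek.
  by have := bfs_mem I v; rewrite all Ek.
have [->|nvr] := eqVneq v r; first by rewrite gdist0.
have [p [epv _ Ep]] := bfs_pred I (all v) nvr.
have {}IH : d r p < k by apply: IH; lia.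
by have := gdist_triangle Ge p r v; rewrite (gdist1 Ge epv); lia.
Qed.

End BFS.

(** * Reasoning about programs *)

Section ProgramLogic.
Variables (R : realType) (B : nat).
Implicit Types (s : state R) (c : cmd) (Q : nat -> state R -> Prop).

(** Evaluation is split into total value functions and the definedness predicates [iok], [rok] and
    [bok], so that goals about programs reduce to arithmetic. *)
Definition iop_val (o : iop) (m n : nat) : nat :=
  match o with
  | IAdd => m + n | ISub => m - n | IMul => m * n | IDiv => m %/ n
  | IMod => m %% n
  end.

Definition rop_val (o : rop) (x y : R) : R :=
  match o with
  | RAdd => x + y | RSub => x - y | RMul => x * y | RDiv => x / y
  end%R.

Fixpoint ival s (a : iexp) : nat :=
  match a with
  | IConst c => c
  | IVar x => ivar s x
  | IGet b i => iarr s b (ival s i)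
  | IBin o a1 a2 => iop_val o (ival s a1) (ival s a2)
  end.

Fixpoint iok s (a : iexp) : Prop :=
  match a with
  | IConst c => c < B
  | IVar x => ivar s x < B
  | IGet b i => iok s i /\ iarr s b (ival s i) < B
  | IBin o a1 a2 =>
      [/\ iok s a1, iok s a2, iop_val o (ival s a1) (ival s a2) < B
        & if o is (IDiv | IMod) then ival s a2 != 0 else true]
  end.

Fixpoint rval s (a : rexp) : R :=
  match a with
  | RConst c => c%:R%R
  | RVar x => rvar s x
  | RGet b i => rarr s b (ival s i)
  | RBin o a1 a2 => rop_val o (rval s a1) (rval s a2)
  end.

Fixpoint rok s (a : rexp) : Prop :=
  match a with
  | RConst _ | RVar _ => True
  | RGet b i => iok s i
  | RBin o a1 a2 =>
      [/\ rok s a1, rok s a2 & if o is RDiv then rval s a2 != 0%R else true]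
  end.

Fixpoint bval s (b : bexp) : bool :=
  match b with
  | BIle a1 a2 => ival s a1 <= ival s a2
  | BRle a1 a2 => (rval s a1 <= rval s a2)%R
  | BNot b1 => ~~ bval s b1
  | BAnd b1 b2 => bval s b1 && bval s b2
  end.

Fixpoint bok s (b : bexp) : Prop :=
  match b with
  | BIle a1 a2 => iok s a1 /\ iok s a2
  | BRle a1 a2 => rok s a1 /\ rok s a2
  | BNot b1 => bok s b1
  | BAnd b1 b2 => bok s b1 /\ bok s b2
  end.

Lemma wordE v : v < B -> word B v = Some v.
Proof. by rewrite /word => ->. Qed.

Lemma ieval_ok s a : iok s a -> ieval B s a = Some (ival s a).
Proof.
elim: a => [c|x|b i IH|o a1 IH1 a2 IH2] /=; try exact: wordE.
  by case=> /IH -> /= /wordE.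
case=> /IH1 -> /IH2 -> /=.
by case: o => /= /wordE -> //; case: eqP.
Qed.

Lemma reval_ok s a : rok s a -> reval B s a = Some (rval s a).
Proof.
elim: a => [c|x|b i|o a1 IH1 a2 IH2] //=; first by move=> /ieval_ok ->.
case=> /IH1 -> /IH2 -> /=.
by case: o => //=; case: eqP.
Qed.

Lemma beval_ok s b : bok s b -> beval B s b = Some (bval s b).
Proof.
elim: b => [a1 a2|a1 a2|b IH|b1 IH1 b2 IH2] /=.
- by case=> /ieval_ok -> /ieval_ok ->.
- by case=> /reval_ok -> /reval_ok ->.
- by move=> /IH ->.
- by case=> /IH1 -> /IH2 ->.
Qed.

Definition run c s Q : Prop := exists t s', exec B c s t s' /\ Q t s'.

Lemma run_weaken c s Q Q' :
  (forall t s', Q t s' -> Q' t s') -> run c s Q -> run c s Q'.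
Proof. by move=> H [t [s' [E q]]]; exists t, s'; split => //; exact: H. Qed.

Lemma run_seq c1 c2 s Q :
  run c1 s (fun t1 s1 => run c2 s1 (fun t2 s2 => Q (t1 + t2) s2)) ->
  run (Seq c1 c2) s Q.
Proof.
move=> [t1 [s1 [E1 [t2 [s2 [E2 q]]]]]]; exists (t1 + t2), s2; split => //.
exact: exec_seq E1 E2.
Qed.

Inductive loc := IVarLoc of nat | IArrLoc of nat | RVarLoc of nat | RArrLoc of nat.

(** Variables and arrays are named by numerals in the program text, so what a program may modify can
    be read off its syntax. *)
Fixpoint writes (l : loc) c : bool :=
  match c with
  | Skip => false
  | ISet x _ => if l is IVarLoc y then y == x else false
  | IPut x _ _ => if l is IArrLoc y then y == x else false
  | RSet x _ => if l is RVarLoc y then y == x else false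
  | RPut x _ _ => if l is RArrLoc y then y == x else false
  | Seq c1 c2 | If _ c1 c2 => writes l c1 || writes l c2
  | While _ c1 => writes l c1
  end.

Definition agree (l : loc) s s' : Prop :=
  match l with
  | IVarLoc x => ivar s' x = ivar s x
  | IArrLoc x => iarr s' x = iarr s x
  | RVarLoc x => rvar s' x = rvar s x
  | RArrLoc x => rarr s' x = rarr s x
  end.

Lemma agree_trans l s1 s2 s3 : agree l s1 s2 -> agree l s2 s3 -> agree l s1 s3.
Proof. by case: l => x /= E1 E2; rewrite E2. Qed.

Definition frame c s s' : Prop := forall l, ~~ writes l c -> agree l s s'.

Lemma exec_frame c s t s' : exec B c s t s' -> frame c s s'.
Proof.
elim=> {c s t s'} [s|s x a v E|s b i a j v E F|s x a v E|s b i a j v E F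
  |c1 c2 s s1 s2 t1 t2 _ IH1 _ IH2|b c1 c2 s s1 t p E _ IH
  |b c s E|b c s s1 s2 t1 t2 E _ IH1 _ IH2] l /=.
- by case: l.
- by case: l => y //=; rewrite /upd => /negPf ->.
- by case: l => y //=; rewrite /upd => /negPf ->.
- by case: l => y //=; rewrite /upd => /negPf ->.
- by case: l => y //=; rewrite /upd => /negPf ->.
- by rewrite negb_or => /andP [/IH1 A1 /IH2]; exact: agree_trans.
- by rewrite negb_or => /andP [w1 w2]; apply: IH; case: (p).
- by case: l.
- by move=> w; apply: agree_trans (IH1 _ w) (IH2 _ w).
Qed.

Lemma run_frame c s Q :
  run c s Q -> run c s (fun t s' => Q t s' /\ frame c s s').
Proof.
by move=> [t [s' [E q]]]; exists t, s'; split => //; split => //; exact: exec_frame E.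
Qed.

(* [I k t s] describes the state after [k] rounds, which took [t] steps. *)
Lemma run_while b c N (I : nat -> nat -> state R -> Prop) s0 :
  I 0 0 s0 ->
  (forall k t s, frame c s0 s -> k < N -> I k t s ->
    [/\ bok s b, bval s b
      & run c s (fun t' s' => I k.+1 (t + (bcost b + t').+1) s')]) ->
  (forall t s, frame c s0 s -> I N t s -> bok s b /\ bval s b = false) ->
  run (While b c) s0
    (fun t s' => exists2 t0, t = t0 + (bcost b).+1 & I N t0 s').
Proof.
move=> I0 IS IN.
(* Induction on the number [m] of rounds left, from any state reached after [k] rounds. *)
suff H m k t s : frame c s0 s -> N = k + m -> I k t s ->
    run (While b c) s
      (fun t' s' => exists2 t0, t + t' = t0 + (bcost b).+1 & I N t0 s').
  by apply: (H N 0 0) => // l _; case: l.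
elim: m k t s => [|m IH] k t s fr EN Ik.
  have {}EN : N = k by rewrite EN addn0.
  rewrite -EN in Ik; have [ok bF] := IN _ _ fr Ik.
  exists (bcost b).+1, s; split; last by exists t.
  by apply: exec_while_false; rewrite beval_ok ?bF.
have ltk : k < N by rewrite EN -addSnnS leq_addr.
have [ok bT [t1 [s1 [E1 I1]]]] := IS _ _ _ fr ltk Ik.
have fr1 : frame c s0 s1.
  by move=> l wl; apply: agree_trans (fr l wl) (exec_frame E1 wl).
have [|t2 [s2 [E2 [t0 Et0 I2]]]] := IH k.+1 _ _ fr1 _ I1; first by rewrite addSnnS.
exists (bcost b + t1 + t2).+1, s2; split.
  by apply: exec_while_true E1 E2; rewrite beval_ok ?bT.
by exists t0; rewrite // -Et0; lia.
Qed.

(** Weakest preconditions for code without loops; a loop gets [False] and is treated by [run_while]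
    instead. *)
Fixpoint wp c (Q : state R -> Prop) s : Prop :=
  match c with
  | Skip => Q s
  | ISet x a => iok s a /\ Q (set_ivar s x (ival s a))
  | IPut b i a =>
      [/\ iok s i, iok s a & Q (set_iarr s b (ival s i) (ival s a))]
  | RSet x a => rok s a /\ Q (set_rvar s x (rval s a))
  | RPut b i a =>
      [/\ iok s i, rok s a & Q (set_rarr s b (ival s i) (rval s a))]
  | Seq c1 c2 => wp c1 (wp c2 Q) s
  | If b c1 c2 => bok s b /\ if bval s b then wp c1 Q s else wp c2 Q s
  | While _ _ => False
  end.

Fixpoint ccost c : nat :=
  match c with
  | Skip => 1
  | ISet _ a => (icost a).+1
  | IPut _ i a => (icost i + icost a).+1
  | RSet _ a => (rcost a).+1
  | RPut _ i a => (icost i + rcost a).+1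
  | Seq c1 c2 => ccost c1 + ccost c2
  | If b c1 c2 => (bcost b + maxn (ccost c1) (ccost c2)).+1
  | While _ _ => 0
  end.

Lemma wp_run c (Q : state R -> Prop) s :
  wp c Q s -> run c s (fun t s' => t <= ccost c /\ Q s').
Proof.
elim: c Q s => [|x a|b i a|x a|b i a|c1 IH1 c2 IH2|b c1 IH1 c2 IH2|//] Q s /=.
- by move=> q; exists 1, s; split => //; constructor.
- case=> /ieval_ok E q; exists (icost a).+1, (set_ivar s x (ival s a)).
  by split => //; constructor.
- case=> /ieval_ok Ei /ieval_ok E q.
  exists (icost i + icost a).+1, (set_iarr s b (ival s i) (ival s a)).
  by split => //; constructor.
- case=> /reval_ok E q; exists (rcost a).+1, (set_rvar s x (rval s a)).
  by split => //; constructor.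
- case=> /ieval_ok Ei /reval_ok E q.
  exists (icost i + rcost a).+1, (set_rarr s b (ival s i) (rval s a)).
  by split => //; constructor.
- move=> /IH1 [t1 [s1 [E1 [l1 /IH2 [t2 [s2 [E2 [l2 q]]]]]]]].
  exists (t1 + t2), s2; split; first exact: exec_seq E1 E2.
  by split => //; exact: leq_add.
- case=> /beval_ok E q.
  have: run (if bval s b then c1 else c2) s
      (fun t s' => t <= maxn (ccost c1) (ccost c2) /\ Q s').
    case: (bval s b) q => [/IH1|/IH2]; apply: run_weaken => t s' [le q];
      by split => //; rewrite leq_max le ?orbT.
  case=> t [s' [E' [le q']]]; exists (bcost b + t).+1, s'; split.
    exact: exec_if E E'.
  by split => //; rewrite ltnS leq_add2l.
Qed.

End ProgramLogic.

(** * The program *)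

(* Integer variables: 0 number of vertices, 1 size of the output, 2 loop
   counter, 3 length of the queue, 4 current vertex, 5 to 7 scan of its
   adjacency list (position, neighbour, end), 8 number of parents, 9 and 10
   largest and smallest class of a parent, 11 a parent of smallest class.
   Integer arrays: 0 and 1 graph, 2 output, 3 queue, 4 levels plus one,
   5 classes, 6 fathers. Real arrays: 0 weights, 1 weights of subtrees,
   2 weights of classes, 3 values of the median function. *)

Ltac split_conj :=
  repeat match goal with
  | |- _ /\ _ => split
  | |- and3 _ _ _ => split
  | |- and4 _ _ _ _ => split
  end.

Ltac solve_ok := split_conj; by [|lia].

Definition for_upto (body : cmd) : cmd :=
  Seq (ISet 2 (IConst 0))
    (While (BIle (IBin IAdd (IVar 2) (IConst 1)) (IVar 0))
      (Seq body (ISet 2 (IBin IAdd (IVar 2) (IConst 1))))).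

Definition for_adj (body : cmd) : cmd :=
  Seq (Seq (ISet 5 (IGet 0 (IVar 4)))
    (ISet 7 (IGet 0 (IBin IAdd (IVar 4) (IConst 1)))))
    (While (BIle (IBin IAdd (IVar 5) (IConst 1)) (IVar 7))
      (Seq (ISet 6 (IGet 1 (IVar 5)))
        (Seq body (ISet 5 (IBin IAdd (IVar 5) (IConst 1)))))).

(** * Rules for the two loop schemes *)

Section Loops.
Variables (R : realType) (B : nat).

(** [I] counts the time of the bodies alone. Each round adds 6 steps for the test and 4 for the
    increment; the last 8 are the initialization and the final test, which evaluates [N + 1] and so
    needs [N.+1 < B]. *)
Lemma run_for_upto body N (I : nat -> nat -> state R -> Prop) s0 :
  ~~ writes (IVarLoc 0) body -> ~~ writes (IVarLoc 2) body ->
  N.+1 < B -> ivar s0 0 = N -> I 0 0 (set_ivar s0 2 0) ->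
  (forall k t s, frame (for_upto body) s0 s -> k < N -> ivar s 2 = k ->
    I k t s ->
    run B body s (fun t' s' => I k.+1 (t + t') (set_ivar s' 2 k.+1))) ->
  run B (for_upto body) s0
    (fun t s => exists2 t0, t <= t0 + 10 * N + 8 & I N t0 s).
Proof.
move=> w0 w2 hB EN I0 IS; apply: run_seq.
have : wp B (ISet 2 (IConst 0)) (fun s => s = set_ivar s0 2 0) s0 by split=> //=; lia.
move=> /wp_run; apply: run_weaken => t1 _ [/= le1 ->].
pose J k t s := exists2 t0, t <= t0 + 10 * k & ivar s 2 = k /\ I k t0 s.
have fr2 s : frame (Seq body (ISet 2 (IBin IAdd (IVar 2) (IConst 1))))
    (set_ivar s0 2 0) s -> frame (for_upto body) s0 s.
  move=> fr l /=; rewrite negb_or => /andP [wl1 wl2].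
  apply: (agree_trans (s2 := set_ivar s0 2 0) _ (fr l wl2)).
  by case: l wl1 {wl2} => //= y /negPf; rewrite /upd => ->.
have := @run_while _ B (BIle (IBin IAdd (IVar 2) (IConst 1)) (IVar 0))
  (Seq body (ISet 2 (IBin IAdd (IVar 2) (IConst 1)))) N J (set_ivar s0 2 0).
case.
- by exists 0.
- move=> k t s /fr2 fr lt [t0 let0 [Ek Ik]].
  have E0 : ivar s 0 = N.
    by rewrite -EN; apply: (fr (IVarLoc 0)); rewrite /= orbF.
  rewrite /= Ek E0; split; [solve_ok|lia|].
  apply: run_seq; have := run_frame (IS _ _ _ fr lt Ek Ik).
  apply: run_weaken => t2 s2 [I2 fr'].
  have E2 : ivar s2 2 = k by rewrite -Ek; exact: (fr' (IVarLoc 2)).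
  have : wp B (ISet 2 (IBin IAdd (IVar 2) (IConst 1)))
      (fun s => s = set_ivar s2 2 k.+1) s2.
    by rewrite /= E2 addn1; solve_ok.
  move=> /wp_run; apply: run_weaken => t3 _ [/= le3 ->].
  by exists (t0 + t2) => //; lia.
- move=> t s /fr2 fr [t0 let0 [Ek Ik]].
  have E0 : ivar s 0 = N.
    by rewrite -EN; apply: (fr (IVarLoc 0)); rewrite /= orbF.
  rewrite /= Ek E0; split; [solve_ok|lia].
- move=> t [s [E [t0 /= Et [t2 le2 [_ IN]]]]]; exists t, s; split => //.
  by exists t2 => //; lia.
Qed.

Variables (V : Type) (adj : V -> seq V) (num : V -> nat) (off nb : nat -> nat).
Variable (x0 : V).
Hypothesis off_adj : forall u, off (num u).+1 = off (num u) + size (adj u).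
Hypothesis nb_adj : forall u k, k < size (adj u) ->
  nb (off (num u) + k) = num (nth x0 (adj u) k).
Hypothesis off_word : forall u, (off (num u).+1).+1 < B.
Hypothesis num_word : forall u, (num u).+1 < B.

(** [J l] describes the state once the prefix [l] is read. Variables 5 and 7 belong to the loop, so
    [J] must hold whatever is written there. The overhead of 13 per neighbour is 6 for the test, 3
    for the fetch and 4 for the increment. *)
Lemma run_for_adj body u (J : seq V -> state R -> Prop) s0 :
  ~~ writes (IVarLoc 5) body -> ~~ writes (IVarLoc 7) body ->
  ~~ writes (IArrLoc 0) body -> ~~ writes (IArrLoc 1) body ->
  iarr s0 0 = off -> iarr s0 1 = nb -> ivar s0 4 = num u ->
  (forall j z, J [::] (set_ivar (set_ivar s0 5 j) 7 z)) ->
  (forall l y l' s, adj u = l ++ y :: l' -> frame (for_adj body) s0 s ->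
    J l s ->
    wp B body (fun s' => forall j, J (rcons l y) (set_ivar s' 5 j))
      (set_ivar s 6 (num y))) ->
  run B (for_adj body) s0
    (fun t s => t <= (ccost body + 13) * size (adj u) + 15 /\ J (adj u) s).
Proof.
move=> w5 w7 w0 w1 E0 E1 E4 J0 JS; apply: run_seq.
have lt_off := off_word u; have lt_num := num_word u.
have le_off := off_adj u.
set j0 := off (num u); set z := off (num u).+1.
set s1 := set_ivar (set_ivar s0 5 j0) 7 z.
set c := Seq _ _.
have : wp B c (fun s => s = s1) s0.
  by rewrite /= /upd /= E4 E0 addn1 -/j0 -/z; solve_ok.
move=> /wp_run; apply: run_weaken => t1 _ [/= le1 ->].
pose K k t s := [/\ t <= (ccost body + 13) * k, ivar s 5 = j0 + k
  & J (take k (adj u)) s].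
set wc := Seq _ _.
have fr2 s : frame wc s1 s -> frame (for_adj body) s0 s.
  move=> fr l /=; rewrite negb_or => /andP [wl1 wl2].
  apply: (agree_trans (s2 := s1) _ (fr l wl2)).
  by case: l wl1 {wl2} => //= y; rewrite /upd negb_or => /andP [/negPf -> /negPf ->].
have := @run_while _ B (BIle (IBin IAdd (IVar 5) (IConst 1)) (IVar 7)) wc
  (size (adj u)) K s1.
case.
- by rewrite /K addn0 muln0 take0; split=> //; exact: J0.
- move=> k t s fr' lt [let0 E5 Jk].
  have fr := fr2 _ fr'.
  have E7 : ivar s 7 = z.
    by apply: (fr' (IVarLoc 7)); rewrite /= (negPf w7).
  have Ea1 : iarr s 1 = nb.
    by rewrite -E1; apply: (fr (IArrLoc 1)); rewrite /= orbF.
  rewrite /= E5 E7; split; [solve_ok|lia|].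
  set y := nth x0 (adj u) k.
  have Ey : nb (j0 + k) = num y by rewrite nb_adj.
  have ly := num_word y.
  apply: run_seq.
  have : wp B (ISet 6 (IGet 1 (IVar 5))) (fun s' => s' = set_ivar s 6 (num y)) s.
    by rewrite /= E5 Ea1 Ey; solve_ok.
  move=> /wp_run; apply: run_weaken => t2 _ [/= le2 ->].
  apply: run_seq.
  have Eadj : adj u = take k (adj u) ++ y :: drop k.+1 (adj u).
    by rewrite -drop_nth // cat_take_drop.
  have := run_frame (wp_run (JS _ _ _ _ Eadj fr Jk)).
  apply: run_weaken => t3 s3 [[le3 J3] fr3].
  have E53 : ivar s3 5 = j0 + k.
    by rewrite (fr3 (IVarLoc 5)).
  have : wp B (ISet 5 (IBin IAdd (IVar 5) (IConst 1)))
      (fun s => s = set_ivar s3 5 (j0 + k.+1)) s3.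
    by rewrite /= E53 addn1 addnS; solve_ok.
  move=> /wp_run; apply: run_weaken => t4 _ [/= le4 ->].
  rewrite /K (take_nth x0) //; split=> //; rewrite mulnS; lia.
- move=> t s fr [let0 E5 Jk].
  have E7 : ivar s 7 = z.
    by apply: (fr (IVarLoc 7)); rewrite /= (negPf w7).
rewrite /= E5 E7; split; [solve_ok|lia].
- move=> t [s [E [t0 /= Et [le2 _ JN]]]]; exists t, s; split => //.
  by rewrite take_size in JN; split => //; lia.
Qed.

End Loops.

(** * Program for the breadth first search *)

Definition bfs_body : cmd :=
  If (BIle (IGet 4 (IVar 6)) (IConst 0))
    (Seq (IPut 3 (IVar 3) (IVar 6))
    (Seq (ISet 3 (IBin IAdd (IVar 3) (IConst 1)))
      (IPut 4 (IVar 6) (IBin IAdd (IGet 4 (IVar 4)) (IConst 1)))))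
    Skip.

(** Levels are stored plus one so that 0, the initial content of memory, marks undiscovered
    vertices. The root is vertex 0, already present in cell 0 of the queue. A counted loop suffices,
    as the queue never runs dry early by [bfs_progress]. *)
Definition bfs : cmd :=
  Seq (Seq (IPut 4 (IConst 0) (IConst 1)) (ISet 3 (IConst 1)))
    (for_upto (Seq (ISet 4 (IGet 3 (IVar 2))) (for_adj bfs_body))).

Section Phases.
Variables (R : realType) (B n : nat).
Local Notation V := 'I_n.+1.
Variables (e : rel V) (adj : V -> seq V) (off nb : nat -> nat).
Hypothesis Ge : connected_simple_graph e.
Hypothesis adjE : forall x, adj x =i e x.
Hypothesis off_adj : forall u : V, off u.+1 = off u + size (adj u).
Hypothesis nb_adj : forall (u : V) k, k < size (adj u) ->
  nb (off u + k) = nth ord0 (adj u) k.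
Hypothesis off_word : forall u : V, (off u.+1).+1 < B.
Hypothesis n_word : n + 3 < B.

Let num_word (u : V) : u.+1 < B.
Proof. by have := ltn_ord u; lia. Qed.

Definition degree_sum := \sum_x size (adj x).

Definition stores (s : state R) (q : seq V) :=
  forall i, i < size q -> iarr s 3 i = nth ord0 q i :> nat.

Local Notation lev s := (fun v : 'I_n.+1 => iarr s 4 v).

Lemma uniq_size_le (q : seq V) : uniq q -> size q <= n.+1.
Proof. by move=> /card_uniqP <-; rewrite -[X in _ <= X]card_ord max_card. Qed.

Lemma run_bfs (s0 : state R) :
  ivar s0 0 = n.+1 -> iarr s0 0 = off -> iarr s0 1 = nb ->
  iarr s0 3 0 = 0 -> (forall i, iarr s0 4 i = 0) ->
  run B bfs s0 (fun t s => exists q : seq V,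
    [/\ bfs_inv e ord0 n.+1 q (lev s), size q = n.+1, stores s q
      & t <= 28 * n.+1 + (ccost bfs_body + 13) * degree_sum + 13]).
Proof.
move=> E0 Eoff Enb Eq El; apply: run_seq.
set s1 := set_ivar (set_iarr s0 4 0 1) 3 1.
have : wp B (Seq (IPut 4 (IConst 0) (IConst 1)) (ISet 3 (IConst 1)))
    (fun s => s = s1) s0.
  by rewrite /=; solve_ok.
move=> /wp_run; apply: run_weaken => t1 _ [/= le1 ->].
set c1 := ccost bfs_body + 13.
(* The scans are charged to the degrees of the dequeued vertices; 18 is 3 for fetching the vertex
   plus the 15 of [run_for_adj]. *)
pose I h t s := exists q : seq V, [/\ bfs_inv e ord0 h q (lev s), h <= size q,
  ivar s 3 = size q, stores s q
  & t <= 18 * h + c1 * \sum_(x <- take h q) size (adj x)].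
apply: run_weaken (@run_for_upto _ B _ n.+1 I s1 _ _ _ _ _ _) => //.
- move=> t s [t0 let0 [q [Iq hq Esz sq let1]]].
  have le := uniq_size_le (bfs_uniq Iq).
  have Eszq : size q = n.+1 by lia.
  exists q; split => //; move: let1; rewrite take_oversize ?Eszq //.
  have -> : \sum_(x <- q) size (adj x) = degree_sum.
    rewrite big_uniq ?(bfs_uniq Iq) //; apply: eq_bigl => x.
    by rewrite (mem_full_ord (bfs_uniq Iq)).
  lia.
- lia.
- exists [:: ord0]; split=> //; last by move=> [|i] //= _; rewrite Eq.
  apply: bfs_init => [|v nv]; rewrite /= /upd //=.
  by rewrite -[0]/(val (ord0 : V)) (inj_eq val_inj) (negPf nv) El.
move=> h t s fr lth Eh [q [Iq hq Esz sq let1]].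
have {hq}hs : h < size q by apply: (bfs_progress Ge Iq) hq; rewrite card_ord.
have le := uniq_size_le (bfs_uniq Iq).
set u := nth ord0 q h.
have Eq3 : iarr s 3 h = u by rewrite sq.
have lu := ltn_ord u.
apply: run_seq.
have : wp B (ISet 4 (IGet 3 (IVar 2))) (fun s' => s' = set_ivar s 4 u) s.
  by rewrite /= Eh Eq3; solve_ok.
move=> /wp_run; apply: run_weaken => t2 _ [/= le2 ->].
(* While [u] is scanned the queue grows only at its end, so [u] keeps its position [h]. *)
pose J (l : seq V) s' := exists p : seq V, let q' := q ++ p in
  [/\ bfs_inv e ord0 h q' (lev s'), ivar s' 3 = size q', stores s' q'
    & forall y : V, y \in l -> y \in q' /\ iarr s' 4 y <= (iarr s' 4 u).+1].
apply: (run_weaken _ (@run_for_adj R B V adj (@nat_of_ord _) off nb ord0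
  off_adj nb_adj off_word num_word bfs_body u J _ _ _ _ _ _ _ _ _ _)) => //=.
- move=> t3 s3 [let3 [p [Ip Esp sp done]]].
  have hs' : h < size (q ++ p) by rewrite size_cat; lia.
  have Eu : nth ord0 (q ++ p) h = u by rewrite nth_cat hs.
  exists (q ++ p); split=> //.
    apply: bfs_next => //; rewrite Eu => y euy; apply: done.
    by rewrite adjE.
  rewrite (take_nth ord0) // Eu take_cat hs -cats1 big_cat big_seq1 /=.
  move: let1 let3; rewrite -/c1 mulnDr; lia.
- by rewrite -Eoff; exact: (fr (IArrLoc 0)).
- by rewrite -Enb; exact: (fr (IArrLoc 1)).
- by move=> j z; exists [::]; rewrite /= cats0.
move=> l y l' s3 El3 fr3 [p [Ip Esp sp done]].
have E4 : ivar s3 4 = u by apply: (fr3 (IVarLoc 4)).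
have euy : e u y by rewrite -[e u y]adjE El3 mem_cat inE eqxx orbT.
set q' := q ++ p in Ip Esp sp done *.
have hs' : h < size q' by rewrite size_cat; lia.
have Eu : nth ord0 q' h = u by rewrite nth_cat hs.
have le' := uniq_size_le (bfs_uniq Ip).
have lev_lt v : lev s3 v <= n.+1.
  have [vq|] := boolP (v \in q'); last by rewrite (bfs_mem Ip) lt0n negbK => /eqP ->.
  have lti : index v q' < size q' by rewrite index_mem.
  by have := bfs_le Ip lti; rewrite nth_index //; lia.
have ly := ltn_ord y; have lly := lev_lt y; have llu := bfs_le Ip hs'.
rewrite Eu in llu; rewrite /= /upd /= E4.
split; first by solve_ok.
case: ifP => Ly; last first.
  move=> /=; exists p; split=> // z; rewrite mem_rcons inE => /orP [/eqP ->|/done //].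
  have yq : y \in q' by rewrite (bfs_mem Ip) lt0n -leqn0 Ly.
  by split => //; have := bfs_last Ip hs' yq; rewrite Eu.
have yq : y \notin q' by rewrite (bfs_mem Ip) -leqNgt.
have luy : u != y.
  by apply: contraNneq yq => <-; rewrite -Eu mem_nth.
have lsz : size q' < n.+1.
  have := uniq_size_le (q := rcons q' y); rewrite rcons_uniq yq (bfs_uniq Ip) size_rcons.
  exact.
rewrite /= Esp; split_conj; try by [|lia].
move=> j; exists (rcons p y); rewrite -rcons_cat -/q'.
have Ip' := bfs_push Ip hs' yq; rewrite Eu in Ip'.
split.
- apply: Ip' => //=; rewrite /upd /= ?eqxx ?addn1 // => v nv.
  by rewrite (inj_eq val_inj) (negPf nv).
- by rewrite /= addn1 size_rcons.
- move=> i; rewrite size_rcons nth_rcons /= /upd /= ltnS leq_eqVlt => /orP [/eqP ->|lt].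
    by rewrite eqxx ltnn.
  by rewrite (ltn_eqF lt) lt sp.
move=> z; rewrite mem_rcons inE /= /upd /= => /orP [/eqP ->|zl].
  by rewrite mem_rcons inE !(inj_eq val_inj) !eqxx /= (negPf luy) addn1.
have [zq lz] := done _ zl.
have nzy : z != y by apply: contraNneq yq => <-.
by rewrite mem_rcons inE zq orbT !(inj_eq val_inj) (negPf luy) (negPf nzy).
Qed.

End Phases.

(** * Program for fathers and classes *)

Definition class_body : cmd :=
  If (BIle (IBin IAdd (IGet 4 (IVar 6)) (IConst 1)) (IGet 4 (IVar 4)))
    (Seq (ISet 8 (IBin IAdd (IVar 8) (IConst 1)))
    (Seq (If (BIle (IVar 9) (IGet 5 (IVar 6))) (ISet 9 (IGet 5 (IVar 6))) Skip)
      (If (BIle (IBin IAdd (IGet 5 (IVar 6)) (IConst 1)) (IVar 10))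
        (Seq (ISet 10 (IGet 5 (IVar 6))) (ISet 11 (IVar 6)))
        Skip)))
    Skip.

(** The running minimum starts at the number of vertices, which exceeds every class. *)
Definition class_init : cmd :=
  Seq (ISet 4 (IGet 3 (IVar 2)))
  (Seq (ISet 8 (IConst 0)) (Seq (ISet 9 (IConst 0)) (ISet 10 (IVar 0)))).

(** With at most one parent the class is the position in the queue, which is the loop counter. The
    root comes first: it gets class 0, and itself as father because variable 11 is still 0. *)
Definition class_record : cmd :=
  Seq (IPut 6 (IVar 4) (IVar 11))
    (If (BIle (IVar 8) (IConst 1)) (IPut 5 (IVar 4) (IVar 2))
      (IPut 5 (IVar 4) (IVar 9))).

Definition classes : cmd :=
  for_upto (Seq class_init (Seq (for_adj class_body) class_record)).

Section ClassesProgram.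
Variables (R : realType) (B n : nat).
Local Notation V := 'I_n.+1.
Variables (e : rel V) (adj : V -> seq V) (off nb : nat -> nat).
Hypothesis adjE : forall x, adj x =i e x.
Hypothesis off_adj : forall u : V, off u.+1 = off u + size (adj u).
Hypothesis nb_adj : forall (u : V) k, k < size (adj u) ->
  nb (off u + k) = nth ord0 (adj u) k.
Hypothesis off_word : forall u : V, (off u.+1).+1 < B.
Hypothesis n_word : n + 3 < B.
Variable q : seq V.
Hypothesis q_uniq : uniq q.
Hypothesis q_size : size q = n.+1.
Hypothesis q_root : nth ord0 q 0 = ord0.
Local Notation par u := (parent e ord0 u).
Hypothesis par_index : forall u p, par u p -> index p q < index u q.
Hypothesis par_ex : forall u, u != ord0 -> exists p, par u p.

Let num_word (u : V) : u.+1 < B.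
Proof. by have := ltn_ord u; lia. Qed.

Definition parents u := [seq p <- adj u | par u p].

Lemma mem_parents u p : (p \in parents u) = par u p.
Proof. by rewrite mem_filter adjE unfold_in /= /parent andbAC andbb. Qed.

Definition class_spec (cl : V -> nat) (fa : V -> V) u :=
  cl u = (if size (parents u) <= 1 then index u q
          else \max_(p <- parents u) cl p) /\
  if u == ord0 then fa u = ord0 else
    par u (fa u) /\ forall p, par u p -> cl (fa u) <= cl p.

(** The specification at [u] reads [cl] only at [u] and at its parents, which precede [u]; so it
    survives the writes made for later vertices. *)
Lemma class_spec_ext cl fa cl' fa' u : fa u = fa' u ->
  (forall p, index p q <= index u q -> cl p = cl' p) ->
  class_spec cl fa u -> class_spec cl' fa' u.
Proof.
move=> Ef Ec [Eu H]; split.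
  rewrite -Ec // Eu; case: ifP => // _; apply: eq_big_seq => p.
  by rewrite mem_parents => /par_index /ltnW /Ec.
move: H; rewrite Ef; case: ifP => // _ [pf m]; split => // p pp.
by rewrite -!Ec ?m // ltnW ?par_index.
Qed.

(* [l] is the part of the adjacency list read so far, and [f0] what variable 11
   held before. *)
Definition scanned (cl : V -> nat) u f0 (l : seq V) (s : state R) :=
  let P := [seq p <- l | par u p] in
  [/\ ivar s 8 = size P, ivar s 9 = \max_(p <- P) cl p
    & if P is [::] then ivar s 10 = n.+1 /\ ivar s 11 = f0 else
      exists2 f, f \in P & [/\ ivar s 11 = f, ivar s 10 = cl f
        & forall p, p \in P -> cl f <= cl p]].

Lemma run_classes (s0 : state R) :
  ivar s0 0 = n.+1 -> iarr s0 0 = off -> iarr s0 1 = nb ->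
  ivar s0 11 = 0 -> (forall v : V, iarr s0 5 v = 0) ->
  (forall v : V, iarr s0 6 v = 0) ->
  stores s0 q -> (forall v : V, iarr s0 4 v = (gdist e ord0 v).+1) ->
  (forall v : V, iarr s0 4 v <= n.+1) ->
  run B classes s0 (fun t s => exists fa : V -> V,
    [/\ forall v : V, iarr s 6 v = fa v, forall v : V, iarr s 5 v <= n,
      forall v, class_spec (fun v : V => iarr s 5 v) fa v
      & t <= 50 * n.+1 + (ccost class_body + 13) * degree_sum adj + 8]).
Proof.
move=> E0 Eoff Enb E11 E5 E6 sq lev lev_le.
have q_all := mem_full_ord q_uniq q_size.
set c1 := ccost class_body + 13.
pose I (h t : nat) (s : state R) := exists fa : V -> V,
  [/\ forall v : V, iarr s 6 v = fa v, forall v : V, iarr s 5 v <= n,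
    forall v, index v q < h -> class_spec (fun v : V => iarr s 5 v) fa v,
    ivar s 11 <= n /\ (h = 0 -> ivar s 11 = 0)
    & t <= 40 * h + c1 * \sum_(x <- take h q) size (adj x)].
apply: run_weaken (@run_for_upto _ B _ n.+1 I s0 _ _ _ _ _ _) => //.
- move=> t s [t0 let0 [fa [Efa le_cl spec _ let1]]].
  exists fa; split => // [v|]; first by apply: spec; rewrite -{2}q_size index_mem.
  move: let1; rewrite take_oversize ?q_size //.
  have -> : \sum_(x <- q) size (adj x) = degree_sum adj.
    by rewrite big_uniq //; apply: eq_bigl => x; rewrite q_all.
  by rewrite -/c1; lia.
- lia.
- exists (fun=> ord0); split => //=.
  + by move=> v; rewrite E5.
  + by rewrite /upd /= E11.
move=> h t s fr lth Eh [fa [Efa le_cl spec [le11 h0] let1]].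
have hs : h < size q by rewrite q_size.
set u := nth ord0 q h.
have iu : index u q = h by rewrite index_uniq.
have Eq3 : iarr s 3 h = u by rewrite -sq //; exact: (congr1 (@^~ h) (fr (IArrLoc 3) isT)).
have E0s : ivar s 0 = n.+1 by rewrite -E0; exact: (fr (IVarLoc 0) isT).
have lu := ltn_ord u.
set cl := fun v : V => iarr s 5 v in spec.
set s1 := set_ivar (set_ivar (set_ivar (set_ivar s 4 u) 8 0) 9 0) 10 n.+1.
apply: run_seq.
have : wp B class_init (fun s' => s' = s1) s.
  by rewrite /= /upd /= Eh Eq3 E0s; solve_ok.
move=> /wp_run; apply: run_weaken => t2 _ [/= le2 ->].
apply: run_seq.
have J0 j z : scanned cl u (ivar s 11) [::] (set_ivar (set_ivar s1 5 j) 7 z).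
  by rewrite /scanned /= big_nil.
have := @run_for_adj R B V adj (@nat_of_ord _) off nb ord0
  off_adj nb_adj off_word num_word class_body u (scanned cl u (ivar s 11)) s1
  isT isT isT isT.
have -> : iarr s1 0 = off by rewrite -Eoff; exact: (fr (IArrLoc 0) isT).
have -> : iarr s1 1 = nb by rewrite -Enb; exact: (fr (IArrLoc 1) isT).
move=> /(_ erefl erefl erefl J0) H.
have max_cl (P : seq V) : \max_(p <- P) cl p <= n.
  elim: P => [|p P IH]; first by rewrite big_nil.
  by rewrite big_cons geq_max IH andbT; exact: le_cl.
have deg_word : size (adj u) < B by have := off_word u; rewrite off_adj; lia.
have lev_s : iarr s 4 = iarr s0 4 by exact: (fr (IArrLoc 4) isT).
have step l y l' s3 : adj u = l ++ y :: l' -> frame (for_adj class_body) s1 s3 ->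
    scanned cl u (ivar s 11) l s3 ->
    wp B class_body (fun s' => forall j, scanned cl u (ivar s 11) (rcons l y)
      (set_ivar s' 5 j)) (set_ivar s3 6 y).
  move=> El3 fr3 [E8 E9 E11'].
  have E4 : ivar s3 4 = u by exact: (fr3 (IVarLoc 4) isT).
  have Ea4 : iarr s3 4 = iarr s0 4 by rewrite -lev_s; exact: (fr3 (IArrLoc 4) isT).
  have Ea5 : iarr s3 5 = iarr s 5 by exact: (fr3 (IArrLoc 5) isT).
  have euy : e u y by rewrite -[e u y]adjE El3 mem_cat inE eqxx orbT.
  have {}deg_word : size l + 2 < B + 1.
    by move: deg_word; rewrite El3 size_cat /=; lia.
  have le8 : size [seq p <- l | par u p] <= size l by rewrite size_filter count_size.
  set P := [seq p <- l | par u p] in E8 E9 E11' le8.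
  have le10 : ivar s3 10 <= n.+1.
    move: E11'; case: (P) => [[-> //]|p0 P0] [f _ [_ -> _]].
    exact: leq_trans (le_cl f) _.
  have nB : n < B by lia.
  have lcy : cl y <= n := le_cl y.
  have lcB : cl y < B := leq_ltn_trans lcy nB.
  have lmx : \max_(p <- P) cl p < B := leq_ltn_trans (max_cl P) nB.
  have lly := lev_le y; have llu := lev_le u; have ly := ltn_ord y.
  rewrite /= /upd /= E4 Ea4 Ea5 E8 E9.
  split; first by solve_ok.
  have -> : (iarr s0 4 y + 1 <= iarr s0 4 u) = par u y.
    by rewrite !lev /parent euy addn1 ltnS.
  case: ifP => py; last first.
    by move=> j; rewrite /scanned filter_rcons py.
  have EP : [seq p <- rcons l y | par u p] = rcons P y by rewrite filter_rcons py.
  have Emax : \max_(p <- rcons P y) cl p = maxn (\max_(p <- P) cl p) (cl y).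
    by rewrite -cats1 big_cat big_seq1.
  have Emin s' : ivar s' 8 = (size P).+1 -> ivar s' 9 = maxn (\max_(p <- P) cl p) (cl y) ->
      (if cl y < ivar s3 10 then ivar s' 10 = cl y /\ ivar s' 11 = y
       else ivar s' 10 = ivar s3 10 /\ ivar s' 11 = ivar s3 11) ->
      forall j, scanned cl u (ivar s 11) (rcons l y) (set_ivar s' 5 j).
    move=> E8' E9' E10' j; rewrite /scanned EP size_rcons Emax; split=> //.
    rewrite /= /upd /=.
    suff : exists2 f, f \in rcons P y & [/\ ivar s' 11 = f, ivar s' 10 = cl f
        & forall p, p \in rcons P y -> cl f <= cl p].
      by case: (P).
    move: E10' E11'; case: ifP => lt [-> ->].
      move=> E11'; exists y; first by rewrite mem_rcons mem_head.
      split=> // p; rewrite mem_rcons inE => /orP [/eqP ->//|].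
      move: E11'; case: (P) => [//|p0 P0] [f _ [_ E10 m]] /m; move: lt; rewrite E10.
      by move=> lt; apply: leq_trans; exact: ltnW.
    case: (P) lt => [lt [E10 _]|p0 P0 lt [f fP [-> E10 m]]].
      by move: lt; rewrite E10 ltnS lcy.
    exists f; first by rewrite mem_rcons inE fP orbT.
    split=> // p; rewrite mem_rcons inE => /orP [/eqP ->|/m //].
    by rewrite leqNgt -E10 lt.
  have -> : iarr s 5 y = cl y by [].
  rewrite !addn1.
  have lcB1 : (cl y).+1 < B by lia.
  split_conj; try by [|lia].
  case: ifP => lt9; split_conj; try by [|lia].
    have {}lt9 := esym (maxn_idPr lt9).
    by case: ifP => lt10; split_conj; try (by [|lia]);
      apply: Emin; rewrite /= /upd /= ?lt10.
  have {}lt9 : \max_(p <- P) cl p = maxn (\max_(p <- P) cl p) (cl y).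
    by apply/esym/maxn_idPl; lia.
  by case: ifP => lt10; split_conj; try (by [|lia]);
    apply: Emin; rewrite /= /upd /= ?E9 ?lt10.
have {}H := run_frame (H step); apply: (run_weaken _ H) => {H}.
move=> t3 s3 [[let3 [E8 E9 E11']] fr3].
have E4 : ivar s3 4 = u by exact: (fr3 (IVarLoc 4) isT).
have E2 : ivar s3 2 = h by rewrite -Eh; exact: (fr3 (IVarLoc 2) isT).
have Ea5 : iarr s3 5 = iarr s 5 by exact: (fr3 (IArrLoc 5) isT).
have Ea6 : iarr s3 6 = iarr s 6 by exact: (fr3 (IArrLoc 6) isT).
rewrite -/(parents u) in E8 E9 E11'.
have [f [Ef f_min]] : exists f : V, ivar s3 11 = f /\
    if u == ord0 then f = ord0 else par u f /\ forall p, par u p -> cl f <= cl p.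
  move: E11'; have [u0|nu0] := eqVneq u ord0.
    have h00 : h = 0 by rewrite -iu u0 -q_root index_uniq ?q_size.
    have -> : parents u = [::].
      apply/eqP; rewrite -(negbK (_ == _)) -has_filter; apply/hasPn => p _.
      by apply/negP => /par_index; rewrite iu h00 ltn0.
    by move=> [_ ->]; exists ord0; rewrite h0.
  have [p] := par_ex nu0; rewrite -mem_parents.
  case Ep : (parents u) => [//|p0 P] _ [f fP [-> _ m]]; exists f.
  rewrite -Ep in fP m; split=> //; split; first by rewrite -mem_parents.
  by move=> p'; rewrite -mem_parents; exact: m.
have [cu Ecu] : exists cu,
    cu = if size (parents u) <= 1 then h else \max_(p <- parents u) cl p.
  by eexists.
have cu_le : cu <= n by rewrite Ecu; case: ifP => // _; rewrite -ltnS.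
have lf := ltn_ord f; have lP : size (parents u) <= size (adj u).
  by rewrite size_filter count_size.
have : wp B class_record (fun s' => s' =
    set_iarr (set_iarr s3 6 u f) 5 u cu) s3.
  rewrite /= /upd /= E4 E8 E9 Ef E2; split; [solve_ok|solve_ok|].
  split; first by solve_ok.
  have nB : n < B by lia.
  by case: ifP => le1; rewrite Ecu le1; split_conj; try (by [|lia]);
    exact: leq_ltn_trans (max_cl _) nB.
move=> /wp_run; apply: run_weaken => t4 _ [/= le4 ->].
exists (fun v => if v == u then f else fa v); split => /=.
- move=> v; rewrite /upd /= Ea6 (inj_eq val_inj); by case: eqP.
- by move=> v; rewrite /upd /= Ea5 (inj_eq val_inj); case: eqP.
- move=> v; rewrite ltnS leq_eqVlt => /orP [/eqP Ev|lt].
    have {Ev v} -> : v = u by rewrite /u -Ev nth_index.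
    (* The write for [u] leaves the classes of its parents alone, since they come earlier in the
       queue. *)
    have Ecl p : par u p -> cl p = (if p == u :> nat then cu else iarr s3 5 p).
      move=> /par_index; rewrite Ea5 (inj_eq val_inj).
      by case: eqP => [->|//]; rewrite ltnn.
    split; rewrite /upd /= eqxx.
      rewrite iu {1}Ecu; case: ifP => // _; apply: eq_big_seq => p.
      by rewrite mem_parents => /Ecl.
    move: f_min; case: ifP => // _ [pf m]; split=> // p pp.
    by rewrite -!Ecl ?m.
  have nvu : v != u by apply: contraTneq lt => ->; rewrite iu ltnn.
  apply: class_spec_ext (spec v lt); first by rewrite (negPf nvu).
  move=> p lp; rewrite /upd /= Ea5 (inj_eq val_inj).
  by case: eqP lp => [->|//]; rewrite iu leqNgt lt.
- by rewrite /upd /= Ef; split => //; lia.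
rewrite (take_nth ord0) // -cats1 big_cat big_seq1 /= -/u.
move: let1 let3; rewrite -/c1 mulnDr; lia.
Qed.

End ClassesProgram.

(** * Degrees and vertices bounded by edges *)

Section Counting.
Variables (n : nat) (e : rel 'I_n) (adj : 'I_n -> seq 'I_n).
Hypothesis e_irr : irreflexive e.
Hypothesis adj_uniq : forall x, uniq (adj x).
Hypothesis adjE : forall x, adj x =i e x.

Lemma sum_degrees_le : \sum_x size (adj x) <= 2 * #|edges e|.
Proof.
have -> : \sum_x size (adj x) = #|[set p : 'I_n * 'I_n | e p.1 p.2]|.
  rewrite -sum1dep_card -(pair_big_dep xpredT (fun x y => e x y) (fun _ _ => 1)) /=.
  apply: eq_bigr => x _; rewrite sum1_card -(card_uniqP (adj_uniq x)).
  exact: eq_card (adjE x).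
(* An arc is recovered from its edge and its direction with respect to the numbering of the
   vertices. *)
pose f (p : 'I_n * 'I_n) := ([set p.1; p.2], p.1 < p.2).
have f_inj : {in [set p | e p.1 p.2] &, injective f}.
  move=> [x y] [x' y']; rewrite !inE /= => exy exy' [/setP E lt].
  have nxy : x != y by apply: contraTneq exy => ->; rewrite e_irr.
  have := E y; have := E x; rewrite !inE !eqxx orbT /=.
  move=> /esym/orP [/eqP Ex|/eqP Ex] /esym/orP [/eqP Ey|/eqP Ey].
  - by rewrite Ex Ey eqxx in nxy.
  - by rewrite Ex Ey.
  - move: lt nxy; rewrite Ex Ey -(inj_eq val_inj) /=; lia.
  - by rewrite Ex Ey eqxx in nxy.
rewrite -(card_in_imset f_inj) mulnC -card_bool -[#|{: bool}|]cardsT -cardsX.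
apply/subset_leq_card/subsetP => A /imsetP [[x y]]; rewrite inE /= => exy ->.
by rewrite inE in_setT andbT; apply/imset2P; exists x y.
Qed.

(** A father edge determines its vertex as the end farther from [r], so the father edges of the
    vertices other than [r] are distinct. This turns time linear in vertices and edges into time
    linear in edges. *)
Lemma card_le_edges (r : 'I_n) (fa : 'I_n -> 'I_n) :
  (forall u, u != r -> parent e r u (fa u)) -> n <= #|edges e|.+1.
Proof.
move=> pf; rewrite -[X in X <= _]card_ord (cardD1 r) inE ltnS.
pose f (u : 'I_n) := [set u; fa u].
have f_inj : {in [predD1 'I_n & r] &, injective f}.
  move=> u v; rewrite !inE !andbT => nu nv /setP E.
  have := E u; have := E v; rewrite !inE !eqxx /= => /orP [/eqP //|/eqP Ev].
  move=> /esym/orP [/eqP//|/eqP Eu]; have /andP [_] := pf u nu; have /andP [_] := pf v nv.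
  by rewrite -Eu -Ev; lia.
rewrite -(card_in_image f_inj); apply: subset_leq_card.
apply/subsetP => A /imageP [u]; rewrite !inE andbT => /pf /andP [euf _] ->.
by apply/imset2P; exists u (fa u).
Qed.

End Counting.

(** * Offsets into the stored adjacency lists *)

Section CSR.
Variables (n : nat) (adj : 'I_n -> seq 'I_n).
Let lists := [seq [seq val y | y <- adj x] | x <- enum 'I_n].
Let off i := if i <= n then size (flatten (take i lists)) else 0.

Lemma nth_lists (u : 'I_n) : nth [::] lists u = [seq val y | y <- adj u].
Proof.
by rewrite (nth_map u) ?size_enum_ord // nth_ord_enum.
Qed.

Lemma offset_step (u : 'I_n) : off u.+1 = off u + size (adj u).
Proof.
have lu := ltn_ord u; rewrite /off lu (ltnW lu) (take_nth [::]); last first.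
  by rewrite size_map size_enum_ord.
by rewrite nth_lists flatten_rcons size_cat size_map.
Qed.

Lemma offset_nth (x0 u : 'I_n) k : k < size (adj u) ->
  nth 0 (flatten lists) (off u + k) = nth x0 (adj u) k.
Proof.
move=> lt; have lu := ltn_ord u.
rewrite -(cat_take_drop u lists) (drop_nth [::]); last first.
  by rewrite size_map size_enum_ord.
rewrite flatten_cat /= nth_lists nth_cat /off (ltnW lu).
rewrite ltnNge leq_addr /= addKn nth_cat size_map lt.
by rewrite (nth_map x0).
Qed.

Lemma offset_le (u : 'I_n) : off u.+1 <= \sum_x size (adj x).
Proof.
have -> : \sum_x size (adj x) = size (flatten lists).
  rewrite size_flatten sumnE /lists !big_map. rewrite -[Finite.enum _]enumT big_enum; apply: eq_bigr => x _.
  by rewrite size_map.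
rewrite /off ltn_ord -{2}(cat_take_drop u.+1 lists) flatten_cat size_cat.
exact: leq_addr.
Qed.

End CSR.

(** * Programs for class weights, median values and the selection of minima *)

Local Open Scope ring_scope.

(** The queue is read backwards, so a vertex is reached after all its children have passed their
    subtree weights to it. *)
Definition weights_body : cmd :=
  Seq (ISet 2 (IBin ISub (IVar 2) (IConst 1)))
  (Seq (ISet 4 (IGet 3 (IVar 2)))
  (Seq (RPut 1 (IVar 4) (RBin RAdd (RGet 1 (IVar 4)) (RGet 0 (IVar 4))))
  (Seq (RPut 2 (IGet 5 (IVar 4))
    (RBin RAdd (RGet 2 (IGet 5 (IVar 4))) (RGet 1 (IVar 4))))
  (RPut 1 (IGet 6 (IVar 4))
    (RBin RAdd (RGet 1 (IGet 6 (IVar 4))) (RGet 1 (IVar 4))))))).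

Definition weights : cmd :=
  Seq (ISet 2 (IVar 0)) (While (BIle (IConst 1) (IVar 2)) weights_body).

(** Entry 0 of the class weights is the total weight [W]. The root, its own father and of class 0,
    gets the value [0 + W - 2 W = - W], so all values are shifted by one constant; the running
    minimum starts at 0, which is no smaller than the value of the root. *)
Definition values_body : cmd :=
  Seq (ISet 4 (IGet 3 (IVar 2)))
  (Seq (RPut 3 (IVar 4)
    (RBin RSub (RBin RAdd (RGet 3 (IGet 6 (IVar 4))) (RGet 2 (IConst 0)))
      (RBin RAdd (RGet 2 (IGet 5 (IVar 4))) (RGet 2 (IGet 5 (IVar 4))))))
  (If (BRle (RGet 3 (IVar 4)) (RVar 0)) (RSet 0 (RGet 3 (IVar 4))) Skip)).

Definition values : cmd := for_upto values_body.

Definition select_body : cmd :=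
  If (BRle (RGet 3 (IVar 2)) (RVar 0))
    (Seq (IPut 2 (IVar 1) (IVar 2)) (ISet 1 (IBin IAdd (IVar 1) (IConst 1))))
    Skip.

Definition select : cmd := for_upto select_body.


Section Weights.
Variables (R : realType) (B n : nat).
Local Notation V := 'I_n.+1.
Hypothesis n_word : (n + 3 < B)%N.
Variable q : seq V.
Hypothesis q_uniq : uniq q.
Hypothesis q_size : size q = n.+1.
Hypothesis q_root : nth ord0 q 0 = ord0.
Variables (cl : V -> nat) (fa : V -> V).
Hypothesis cl_le : forall v, (cl v <= n)%N.
Hypothesis fa_root : fa ord0 = ord0.
Hypothesis fa_index : forall v, v != ord0 -> (index (fa v) q < index v q)%N.

(** The path of fathers from [v] to the root meets class [c] once if [v] is in [b] and never
    otherwise. It is used for a halfspace with its class and for all vertices with class 0; the test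
    [v != ord0] stops the path at the root, its own father. *)
Definition cut (b : {set V}) (c : nat) := forall v,
  (v \in b) = (((v != ord0) && (fa v \in b)) + (cl v == c))%N :> nat.

Definition classified (s : state R) :=
  [/\ stores s q, forall v : V, iarr s 5 v = cl v
    & forall v : V, iarr s 6 v = fa v].

Lemma run_weights (w : V -> R) (s0 : state R) :
  ivar s0 0 = n.+1 -> classified s0 ->
  (forall v : V, rarr s0 0 v = w v) ->
  (forall i, rarr s0 1 i = 0) -> (forall i, rarr s0 2 i = 0) ->
  run B weights s0 (fun t s =>
    (t <= (ccost weights_body + 4) * n.+1 + 10)%N /\
    forall b c, cut b c -> rarr s 2 c = \sum_(v in b) w v).
Proof.
move=> E0 [sq E5 E6] Ew ES EH; apply: run_seq.
have : wp B (ISet 2 (IVar 0)) (fun s => s = set_ivar s0 2 n.+1) s0.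
  by rewrite /= E0; solve_ok.
move=> /wp_run; apply: run_weaken => t1 _ [/= le1 ->].
set s1 := set_ivar s0 2 n.+1.
set c1 := (ccost weights_body + 4)%N.
(* A conservation law: what class [c] has received, plus the loads of the pending vertices of [b],
   is the weight of [b]. Processing [u] moves its load [sg] to its class and to its father, as the
   equation of [cut] prescribes. *)
pose I (k t : nat) (s : state R) := [/\ (t <= c1 * k)%N,
  ivar s 2 = (n.+1 - k)%N
  & forall b c, cut b c -> rarr s 2 c
      + \sum_(v | (index v q < n.+1 - k)%N) (rarr s 1 v + w v) *+ (v \in b)
    = \sum_(v in b) w v].
apply: run_weaken (@run_while _ B _ _ n.+1 I s1 _ _ _).
- move=> t s [t0 /= -> [let0 _ inv]]; split; first by lia.
  by move=> b c /inv <-; rewrite subnn big_pred0 ?addr0.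
- split => //.
  move=> b c _; rewrite EH add0r subn0 [RHS]big_mkcond /=.
  apply: eq_big => v; first by rewrite -[X in (_ < X)%N]q_size index_mem mem_full_ord.
  by rewrite ES add0r; case: (v \in b).
- move=> k t s fr lt [let0 E2 inv].
  set h := (n - k)%N.
  have Eh : (n.+1 - k = h.+1)%N by rewrite /h; lia.
  have hs : (h < size q)%N by rewrite q_size /h; lia.
  set u := nth ord0 q h.
  have iu : index u q = h by rewrite index_uniq.
  have Eq3 : iarr s 3 h = u by rewrite -sq //; exact: (congr1 (@^~ h) (fr (IArrLoc 3) isT)).
  have E5u : iarr s 5 u = cl u by rewrite -E5; exact: (congr1 (@^~ _) (fr (IArrLoc 5) isT)).
  have E6u : iarr s 6 u = fa u by rewrite -E6; exact: (congr1 (@^~ _) (fr (IArrLoc 6) isT)).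
  have Ewu : rarr s 0 u = w u by rewrite -Ew; exact: (congr1 (@^~ _) (fr (RArrLoc 0) isT)).
  have lu := ltn_ord u; have lf := ltn_ord (fa u); have lc := cl_le u.
  have lh : (h <= n)%N by rewrite leq_subr.
  rewrite /= E2 Eh; split; [solve_ok|by []|].
  set sg := rarr s 1 u + w u.
  set s2 := set_rarr (set_rarr (set_rarr (set_ivar (set_ivar s 2 h) 4 u) 1 u sg)
    2 (cl u) (rarr s 2 (cl u) + sg)) 1 (fa u)
    ((if fa u == u then sg else rarr s 1 (fa u)) + sg).
  have : wp B weights_body (fun s' => s' = s2) s.
    rewrite /= /upd /= E2 Eh subn1 /= Eq3 E5u E6u Ewu eqxx (inj_eq val_inj).
    by solve_ok.
  move=> /wp_run; apply: run_weaken => t2 _ [le2 ->].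
  split; first by rewrite mulnS /c1; move: le2 let0; rewrite -/c1; lia.
    by rewrite /= /upd /=; lia.
  move=> b c cbc; rewrite -(inv b c cbc) Eh.
  have -> : (n.+1 - k.+1 = h)%N by rewrite /h; lia.
  rewrite [in RHS](bigD1 u) ?iu //.
  have Es v : (index v q < h.+1)%N && (v != u) = (index v q < h)%N.
    rewrite ltnS leq_eqVlt -iu.
    have -> : (index v q == index u q) = (v == u).
      by apply/eqP/eqP => [|-> //]; apply: index_inj => //; exact: mem_full_ord.
    by case: eqP => [->|_]; rewrite ?ltnn ?andbT.
  rewrite (eq_bigl _ _ Es).
  have EHs : rarr s2 2 c = rarr s 2 c + sg *+ (cl u == c).
    by rewrite /= /upd /= eq_sym; case: eqP => [->|_]; rewrite ?mulr1n ?addr0.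
  have ESs v : (index v q < h)%N -> rarr s2 1 v = rarr s 1 v + sg *+ (v == fa u).
    move=> lv; have nvu : v != u by apply: contraTneq lv => ->; rewrite iu ltnn.
    rewrite /= /upd /= !(inj_eq val_inj) (negPf nvu).
    case: (eqVneq v (fa u)) => [Ev|_]; last by rewrite addr0.
    by rewrite -Ev (negPf nvu).
  (* At the root nothing is pending any more, so the load passed to its father, itself, is not
     counted. *)
  have Esum : \sum_(v | (index v q < h)%N) sg *+ (v == fa u) *+ (v \in b)
      = sg *+ ((u != ord0) && (fa u \in b)).
    have [u0|nu] := eqVneq u ord0.
      rewrite big_pred0 // => v; rewrite -iu u0 -{1}q_root index_uniq ?q_size //.
    rewrite (bigD1 (fa u)) /=; last by rewrite -iu fa_index.
    rewrite eqxx big1 ?addr0 // => v /andP [_ /negPf ->].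
    by rewrite mul0rn.
  have Enew : \sum_(v | (index v q < h)%N) (rarr s2 1 v + w v) *+ (v \in b)
      = \sum_(v | (index v q < h)%N) (rarr s 1 v + w v) *+ (v \in b)
        + sg *+ ((u != ord0) && (fa u \in b)).
    rewrite -Esum -big_split; apply: eq_bigr => v lv.
    by rewrite ESs // addrAC mulrnDl.
  rewrite EHs Enew (cbc u) mulrnDr.
  rewrite -/sg -!addrA; congr (_ + _); rewrite addrA [LHS]addrAC; congr (_ + _); exact: addrC.
- move=> t s fr [_ E2 _]; rewrite /= E2 subnn; split; [solve_ok|by []].
Qed.

Lemma run_values (F : V -> R) (s0 : state R) :
  ivar s0 0 = n.+1 -> classified s0 -> rvar s0 0 = 0 ->
  rarr s0 3 0 = 0 -> cl ord0 = 0%N -> 0 <= rarr s0 2 0 ->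
  (forall v, v != ord0 ->
    F v = F (fa v) + rarr s0 2 0 - 2 * rarr s0 2 (cl v)) ->
  run B values s0 (fun t s => (t <= (ccost values_body + 10) * n.+1 + 8)%N /\
    [/\ forall v : V, rarr s 3 v = F v - F ord0 - rarr s0 2 0,
      forall v : V, rvar s 0 <= rarr s 3 v & exists v : V, rvar s 0 = rarr s 3 v]).
Proof.
move=> E0 [sq E5 E6] Eb ED0 Ecl0 W0 EF.
set W := rarr s0 2 0 in W0 EF *.
pose D v := F v - F ord0 - W.
set c1 := ccost values_body.
pose I (h t : nat) (s : state R) := [/\ (t <= c1 * h)%N,
  forall v : V, (index v q < h)%N -> rarr s 3 v = D v /\ rvar s 0 <= D v,
  h = 0%N -> rarr s 3 0 = 0
  & rvar s 0 = 0 \/ exists v, rvar s 0 = D v].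
apply: run_weaken (@run_for_upto _ B _ n.+1 I s0 _ _ _ _ _ _) => //.
- move=> t s [t0 let0 [let1 inv _ ex]]; split; first by rewrite mulnDl; lia.
  have {}inv (v : V) : rarr s 3 v = D v /\ rvar s 0 <= D v.
    by apply: inv; rewrite -[X in (_ < X)%N]q_size index_mem mem_full_ord.
  split=> [v|v|]; [by have [->] := inv v|by have [->] := inv v|].
  (* If the minimum is still the initial 0, then the value at the root is at least 0 by the
     invariant and at most 0 by its formula, so it attains the minimum. *)
  case: ex => [E|[v Ev]]; last by exists v; have [->] := inv v.
  exists ord0; have [-> le] := inv ord0; apply/eqP; rewrite eq_le le E /=.
  by rewrite /D subrr sub0r oppr_le0.
- lia.
- split => //.
  by left; rewrite /= Eb.
move=> h t s fr lth Eh [let1 inv h0 ex].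
have hs : (h < size q)%N by rewrite q_size.
set u := nth ord0 q h.
have iu : index u q = h by rewrite index_uniq.
have Eq3 : iarr s 3 h = u by rewrite -sq //; exact: (congr1 (@^~ h) (fr (IArrLoc 3) isT)).
have E5u : iarr s 5 u = cl u by rewrite -E5; exact: (congr1 (@^~ _) (fr (IArrLoc 5) isT)).
have E6u : iarr s 6 u = fa u by rewrite -E6; exact: (congr1 (@^~ _) (fr (IArrLoc 6) isT)).
have EH : rarr s 2 = rarr s0 2 by exact: (fr (RArrLoc 2) isT).
have lu := ltn_ord u; have lf := ltn_ord (fa u); have lc := cl_le u.
have ED : rarr s 3 (fa u) + W - (rarr s0 2 (cl u) + rarr s0 2 (cl u)) = D u.
  have [u0|nu] := eqVneq u ord0.
    rewrite u0 fa_root h0; last by rewrite -iu u0 -q_root index_uniq ?q_size.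
    by rewrite Ecl0 -/W /D; ring.
  have [|-> _] := inv (fa u); first by rewrite -iu fa_index.
  by rewrite /D (EF u nu); ring.
set s1 := set_rarr (set_ivar s 4 u) 3 u (D u).
have : wp B values_body (fun s' => s' =
    if D u <= rvar s 0 then set_rvar s1 0 (D u) else s1) s.
  rewrite /= /upd /= Eh Eq3 E5u E6u EH -/W ED eqxx.
  by case: ifP => le; rewrite le; solve_ok.
move=> /wp_run; apply: run_weaken => t2 _ [le2 ->].
have Es : let s' := set_ivar (if D u <= rvar s 0 then set_rvar s1 0 (D u) else s1) 2 h.+1 in
    rarr s' 3 = upd (rarr s 3) u (D u) /\
    rvar s' 0 = if D u <= rvar s 0 then D u else rvar s 0.
  by case: ifP.
move: Es => /=; set s' := set_ivar _ _ _ => -[Es3 Es0].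
split => //; first by rewrite mulnS; lia.
  move=> v; rewrite ltnS leq_eqVlt => /orP [/eqP Ev|lt].
    have -> : v = u by rewrite /u -Ev nth_index // mem_full_ord.
    rewrite Es3 Es0 /upd eqxx; split => //.
    by case: ifP => //; move/negbT; rewrite -ltNge => /ltW.
  have nvu : v != u by apply: contraTneq lt => ->; rewrite iu ltnn.
  have [Ev le] := inv v lt.
  rewrite Es3 Es0 /upd (inj_eq val_inj) (negPf nvu) Ev; split=> //.
  by case: ifP => // le'; exact: le_trans le' le.
rewrite Es0; case: ifP => _ //.
by right; exists u.
Qed.

End Weights.

Lemma run_select (R : realType) (B n : nat) (s0 : state R) :
  (n + 3 < B)%N -> ivar s0 0 = n.+1 -> ivar s0 1 = 0%N ->
  run B select s0 (fun t s => (t <= (ccost select_body + 10) * n.+1 + 8)%N /\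
    mkseq (iarr s 2) (ivar s 1)
      = [seq i <- iota 0 n.+1 | rarr s0 3 i <= rvar s0 0]).
Proof.
move=> n_word E0 E1; set c1 := ccost select_body.
pose I (h t : nat) (s : state R) := [/\ (t <= c1 * h)%N, (ivar s 1 <= h)%N
  & mkseq (iarr s 2) (ivar s 1)
    = [seq i <- iota 0 h | rarr s0 3 i <= rvar s0 0]].
apply: run_weaken (@run_for_upto _ B _ n.+1 I s0 _ _ _ _ _ _) => //.
- by move=> t s [t0 let0 [let1 _ E]]; split => //; rewrite mulnDl; lia.
- lia.
- by split; rewrite /= /upd /= ?E1 ?muln0.
move=> h t s fr lth Eh [let1 le1 E].
have ED : rarr s 3 = rarr s0 3 by exact: (fr (RArrLoc 3) isT).
have Eb : rvar s 0 = rvar s0 0 by exact: (fr (RVarLoc 0) isT).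
set s1 := set_ivar (set_iarr s 2 (ivar s 1) h) 1 (ivar s 1).+1.
have : wp B select_body (fun s' => s' =
    if rarr s0 3 h <= rvar s0 0 then s1 else s) s.
  rewrite /= /upd /= Eh ED Eb addn1; split; first by solve_ok.
  by case: ifP => le; rewrite le; solve_ok.
move=> /wp_run; apply: run_weaken => t2 _ [le2 ->].
rewrite /I -[X in iota _ X]addn1 iotaD filter_cat add0n /= -E.
case: ifP => _; last first.
  by rewrite cats0 /= /upd /=; split=> //; rewrite ?mulnS; lia.
split; [by rewrite mulnS; lia|by []|rewrite /= /upd /=].
rewrite mkseqS -cats1 /= eqxx; congr (_ ++ _).
apply/eq_in_map => i; rewrite mem_iota add0n => /andP [_ lt].
by rewrite (ltn_eqF lt).
Qed.

(** * From the computed arrays to the median set *)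

Section Correctness.
Variables (n : nat).
Local Notation V := 'I_n.+1.
Variables (e : rel V) (adj : V -> seq V).
Hypothesis Me : median_graph e.
Hypothesis adj_uniq : forall x, uniq (adj x).
Hypothesis adjE : forall x, adj x =i e x.
Variable q : seq V.
Hypothesis q_uniq : uniq q.
Hypothesis q_size : size q = n.+1.
Hypothesis q_root : nth ord0 q 0 = ord0.
Hypothesis q_dist : forall x y, (index x q < index y q)%N ->
  (gdist e ord0 x <= gdist e ord0 y)%N.
Variables (cl : V -> nat) (fa : V -> V).
Hypothesis cl_fa : forall v, class_spec e adj q cl fa v.
Local Notation par u := (parent e ord0 u).
Local Notation pos := (index^~ q).

Let pos_inj : injective pos.
Proof. by move=> x y; apply: (@index_inj _ ord0 q); exact: mem_full_ord. Qed.

Let pos_root : pos ord0 = 0%N.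
Proof. by rewrite -{1}q_root index_uniq ?q_size. Qed.

Lemma father_parent u : u != ord0 -> par u (fa u).
Proof. by move=> nu; have [_] := cl_fa u; rewrite (negPf nu) => -[]. Qed.

Lemma father_root : fa ord0 = ord0.
Proof. by have [_] := cl_fa ord0. Qed.

Lemma father_min u p : u != ord0 -> par u p -> (cl (fa u) <= cl p)%N.
Proof. by move=> nu; have [_] := cl_fa u; rewrite (negPf nu) => -[_]; apply. Qed.

Lemma class_single u : (forall p p', par u p -> par u p' -> p = p') -> cl u = pos u.
Proof.
move=> one; have [-> _] := cl_fa u; case: ifP => // /negbT; rewrite -ltnNge.
have := filter_uniq (par u) (adj_uniq u); rewrite -/(parents e adj u).
case E : (parents e adj u) => [|p [|p' P]] //= /andP [np _] _.
case/negP: np; rewrite inE (one p p') ?eqxx // -(mem_parents adjE) E !inE eqxx //.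
by rewrite orbT.
Qed.

Lemma class_max u p p' : par u p -> par u p' -> p != p' ->
  (exists2 v, par u v & cl u = cl v) /\ forall v, par u v -> (cl v <= cl u)%N.
Proof.
move=> pp pp' npp'; have [-> _] := cl_fa u.
have uP : uniq (parents e adj u) by exact: filter_uniq.
rewrite leqNgt (_ : (1 < _)%N); last first.
  have := @uniq_leq_size _ [:: p; p'] (parents e adj u).
  rewrite /= inE npp'; apply => // x.
  by rewrite !inE (mem_parents adjE) => /orP [/eqP ->|/eqP ->].
rewrite big_uniq //=; split; last first.
  by move=> v; rewrite -(mem_parents adjE); exact: leq_bigmax_cond.
have [|v] := @eq_bigmax_cond _ (mem (parents e adj u)) cl.
  by apply/card_gt0P; exists p; rewrite /= (mem_parents adjE).
by rewrite /= (mem_parents adjE) => pv ->; exists v.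
Qed.

Let cl_root : cl ord0 = 0%N.
Proof. exact: (cl_root Me class_single pos_root). Qed.

Let cl_eq0 u : (cl u == 0%N) = (u == ord0).
Proof.
exact: (cl_eq0 Me pos_inj q_dist father_parent father_min class_single class_max pos_root).
Qed.

(** Only the root has class 0, and every path of fathers ends there. *)
Lemma cut_full : cut cl fa setT 0.
Proof. by move=> v; rewrite !in_setT andbT cl_eq0; case: eqP. Qed.

Lemma cut_halfspace u : u != ord0 -> cut cl fa (halfspace e u (fa u)) (cl u).
Proof.
move=> nu v; have [->|nv] := eqVneq v ord0.
  rewrite cl_root eq_sym cl_eq0 (negPf nu).
  by rewrite (negPf (parent_root (father_parent nu))).
exact: (halfspace_cut Me pos_inj q_dist father_parent father_min class_single class_max).
Qed.

Variables (R : realType) (B : nat) (w : V -> R).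
Hypothesis w_ge0 : forall v, 0 <= w v.
Hypothesis n_word : (n + 3 < B)%N.

Lemma run_median (s0 : state R) :
  ivar s0 0 = n.+1 -> ivar s0 1 = 0%N -> classified q cl fa s0 ->
  (forall v : V, rarr s0 0 v = w v) ->
  (forall i, rarr s0 1 i = 0) -> (forall i, rarr s0 2 i = 0) ->
  rarr s0 3 0 = 0 -> rvar s0 0 = 0 -> (forall v, (cl v <= n)%N) ->
  run B (Seq weights (Seq values select)) s0 (fun t s =>
    (t <= (ccost weights_body + ccost values_body + ccost select_body + 24) * n.+1 + 26)%N
    /\ outputs s (median_set e w)).
Proof.
move=> E0 E1 cs Ew ES EH ED Eb cl_le.
have par_pos u : u != ord0 -> (pos (fa u) < pos u)%N.
  by move/father_parent; exact: (parent_pos Me pos_inj q_dist).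
apply: run_seq.
have := run_frame (run_weights n_word q_uniq q_size q_root cl_le
  par_pos E0 cs Ew ES EH).
apply: run_weaken => t1 s1 [[le1 Hcut] fr1].
have W1 : rarr s1 2 0 = \sum_v w v.
  by rewrite (Hcut _ _ cut_full); apply: eq_bigl => v; rewrite in_setT.
apply: run_seq.
have cs1 : classified q cl fa s1.
  have [sq c5 c6] := cs; split.
  - by move=> i li; rewrite (fr1 (IArrLoc 3) isT); exact: sq.
  - by move=> v; rewrite (fr1 (IArrLoc 5) isT).
  - by move=> v; rewrite (fr1 (IArrLoc 6) isT).
have E01 : ivar s1 0 = n.+1 by rewrite (fr1 (IVarLoc 0) isT).
(* The class of the father edge of [v] carries the weight of the halfspace on the side of [v], and
   class 0 the total weight. *)
have EF v : v != ord0 -> median_fun e w v =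
    median_fun e w (fa v) + rarr s1 2 0 - 2 * rarr s1 2 (cl v).
  move=> nv; rewrite W1 (Hcut _ _ (cut_halfspace nv)).
  by apply: median_fun_edge => //; case/andP: (father_parent nv).
have := run_frame (run_values n_word q_uniq q_size q_root cl_le father_root
  par_pos (F := median_fun e w) E01 cs1 _ _ cl_root _ EF).
rewrite (fr1 (RVarLoc 0) isT) (fr1 (RArrLoc 3) isT) W1 sumr_ge0 // => H.
apply: run_weaken (H Eb ED isT) => {H} t2 s2 [[le2 [HD min_le [m Em]]] fr2].
have E02 : ivar s2 0 = n.+1 by rewrite (fr2 (IVarLoc 0) isT).
have E12 : ivar s2 1 = 0%N by rewrite (fr2 (IVarLoc 1) isT) (fr1 (IVarLoc 1) isT).
apply: run_weaken (run_select n_word E02 E12) => t3 s3 [le3 out].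
split.
  move: (ccost weights_body) (ccost values_body) (ccost select_body) le1 le2 le3.
  by move=> a b c; rewrite !mulnDl; lia.
rewrite /outputs out; apply: uniq_perm.
- by rewrite filter_uniq ?iota_uniq.
- by rewrite (map_inj_uniq val_inj) enum_uniq.
(* The stored values differ from the median function by one constant, which cancels in
   comparisons. *)
have sel (v : V) : (rarr s2 3 v <= rvar s2 0) = (v \in median_set e w).
  rewrite inE; apply/idP/forallP => [le x|min].
    by have := le_trans le (min_le x); rewrite !HD !lerD2r.
  by rewrite Em !HD !lerD2r.
move=> i; rewrite mem_filter mem_iota add0n /=; apply/andP/mapP => [[le lt]|[v]].
  by exists (Ordinal lt) => //; rewrite mem_enum -sel.
by rewrite mem_enum -sel => le ->; split.
Qed.

End Correctness.

(** * The whole program with its time and word bounds *)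

Definition median_program : cmd :=
  Seq bfs (Seq classes (Seq weights (Seq values select))).

(* Words have O(log (n + m)) bits; [m.+1] instead of [m] only matters for the
   one-vertex graph, which has no edge. *)
Theorem theorem5p5 (R : realType) :
  exists (P : cmd) (C k : nat),
  forall (n : nat) (e : rel 'I_n) (adj : 'I_n -> seq 'I_n) (w : 'I_n -> R),
    median_graph e -> adjacency_lists e adj -> (forall v, 0 <= w v) ->
    exists (t : nat) (s : state R),
      [/\ exec ((n + #|edges e|).+2 ^ k)%N P (input adj w) t s,
          (t <= C * #|edges e|.+1)%N
        & outputs s (median_set e w)].
Proof.
(* The phases take at most 28 + 50 + 200 steps per vertex and 2 * (60 + 80) per edge, plus a
   constant; as there are at most [#|edges e|.+1] vertices, 1000 is ample. *)
exists median_program, 1000%N, 2%N => n e adj w Me adjP w_ge0.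
have [Ge _] := Me; have [_ e_irr n_gt0 _] := Ge.
case: n e adj w Me adjP w_ge0 Ge e_irr n_gt0 => [|n] e adj w Me adjP w_ge0 Ge e_irr n_gt0.
  by rewrite card_ord in n_gt0.
set B := (_ ^ 2)%N.
have adj_uniq x : uniq (adj x) by have [] := adjP x.
have adjE x : adj x =i e x by have [] := adjP x.
set s0 := input adj w.
have deg_le : (degree_sum adj <= 2 * #|edges e|)%N := sum_degrees_le e_irr adj_uniq adjE.
(* The exponent 2 gives room for a constant factor: offsets can reach twice the number of edges, and
   small increments are added to them. *)
have B_ge : (3 * (n + #|edges e| + 3) <= B)%N by rewrite /B; nia.
have n_word : (n + 3 < B)%N by lia.
have off_word (u : 'I_n.+1) : ((iarr s0 0 u.+1).+1 < B)%N.
  have : (iarr s0 0 u.+1 <= degree_sum adj)%N := offset_le adj u.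
  by lia.
have run1 := run_frame (run_bfs (s0 := s0) Ge adjE (offset_step adj)
  (@offset_nth _ adj ord0) off_word n_word erefl erefl erefl erefl (fun=> erefl)).
suff run_P : run B median_program s0 (fun t s =>
    (t <= 1000 * #|edges e|.+1)%N /\ outputs s (median_set e w)).
  by have [t [s [ex [le out]]]] := run_P; exists t, s.
apply: run_seq.
apply: run_weaken run1 => t1 s1 [[q [Iq q_size sq le1]] fr1].
have q_uniq := bfs_uniq Iq; have [_ q_root] := bfs_head Iq.
have q_all : forall v, v \in q := mem_full_ord q_uniq q_size.
have lev (v : 'I_n.+1) : iarr s1 4 v = (gdist e ord0 v).+1.
  by apply: (bfs_level Ge (q := q) (L := fun v : 'I_n.+1 => iarr s1 4 v)); rewrite card_ord.
have q_dist x y : (index x q < index y q)%N -> (gdist e ord0 x <= gdist e ord0 y)%N.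
  move=> /ltnW lt; have := bfs_sorted Iq lt; rewrite index_mem q_all => /(_ isT).
  by rewrite !nth_index // !lev ltnS.
have pos_inj : injective (index^~ q).
  by move=> x y; apply: (@index_inj _ ord0 q); exact: q_all.
have lev_le (v : 'I_n.+1) : (iarr s1 4 v <= n.+1)%N.
  have lt : (index v q < size q)%N by rewrite index_mem.
  by have := bfs_le Iq lt; rewrite nth_index // => /leq_trans; apply; rewrite -[X in (_ < X)%N]q_size.
apply: run_seq.
have := run_frame (run_classes (s0 := s1) adjE (offset_step adj)
  (@offset_nth _ adj ord0) off_word n_word q_uniq q_size q_root
  (parent_pos Me pos_inj q_dist) (parent_ex Me (r := ord0))
  (fr1 (IVarLoc 0) isT) (fr1 (IArrLoc 0) isT) (fr1 (IArrLoc 1) isT)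
  (fr1 (IVarLoc 11) isT) _ _ sq lev lev_le).
rewrite (fr1 (IArrLoc 5) isT) (fr1 (IArrLoc 6) isT) => H.
apply: run_weaken (H (fun=> erefl) (fun=> erefl)) => {H} t2 s2.
move=> [[fa [Efa cl_le spec le2]] fr2].
have cs : classified q (fun v : 'I_n.+1 => iarr s2 5 v) fa s2.
  by split=> // i li; rewrite (fr2 (IArrLoc 3) isT); exact: sq.
have keep l : ~~ writes l bfs -> ~~ writes l classes -> agree l s0 s2.
  by move=> /fr1 a1 /fr2; exact: agree_trans.
apply: run_weaken (run_median Me adj_uniq adjE q_uniq q_size q_root q_dist spec
  w_ge0 n_word (s0 := s2) _ _ cs _ _ _ _ _ cl_le).
- move=> t3 s3 [le3 out]; split => //.
  have n_le : (n.+1 <= #|edges e|.+1)%N.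
    by apply: (card_le_edges (fa := fa)); exact: father_parent spec.
  have b1 : (ccost bfs_body + 13 <= 60)%N by [].
  have b2 : (ccost class_body + 13 <= 80)%N by [].
  have b3 : (ccost weights_body + ccost values_body + ccost select_body + 24 <= 200)%N.
    by [].
  move: (leq_mul b1 deg_le) (leq_mul b2 deg_le) (leq_mul b3 n_le) le1 le2 le3.
  by lia.
- exact: (keep (IVarLoc 0) isT isT).
- exact: (keep (IVarLoc 1) isT isT).
- move=> v; rewrite (keep (RArrLoc 0) isT isT) /= /upd /=.
  by rewrite valK.
- by move=> i; rewrite (keep (RArrLoc 1) isT isT).
- by move=> i; rewrite (keep (RArrLoc 2) isT isT).
- by rewrite (keep (RArrLoc 3) isT isT).
- exact: (keep (RVarLoc 0) isT isT).
Qed.
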